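(* Assume $F$ is known to the bidder and satisfies Assumptions 1 and 2 (with constants $\Delta,c_f,C_f,\lambda$), and $F(b^*_{v,F})>0$. Then for any $\gamma>1$ the regret of UCBid1 satisfies $$R_T^{v,F}\ \le\ \frac{2\gamma\lambda C_f^2}{F(b^*_{v,F})\,c_f}\log^2 T+O(\log T).$$
   Context: Model: at rounds $t=1,\dots,T$ a bidder submits $B_t\in[0,1]$. $(V_t)_{t\ge1}$ i.i.d. in $[0,1]$ with mean $v$; $(M_t)_{t\ge1}$ i.i.d. in $[0,1]$ with CDF $F$, independent of $(V_t)$. If $M_t\le B_t$ the bidder wins, pays $B_t$ and receives and observes $V_t$; otherwise she does not observe $V_t$. $U_{v,F}(b)=(v-b)F(b)$, $b^*_{v,F}=\max\{\operatorname{argmax}_{b\in[0,1]}U_{v,F}(b)\}$, regret $R_T^{v,F}=T\max_bU_{v,F}(b)-\sum_{t=1}^T\mathbb E[U_{v,F}(B_t)]$. Notation: $N_t=\sum_{s=1}^{t-1}\mathbf 1\{M_s\le B_s\}$, $\hat V_t=\frac1{N_t}\sum_{s=1}^{t-1}V_s\mathbf 1\{M_s\le B_s\}$, $\epsilon_t=\sqrt{\gamma\log(t-1)/(2N_t)}$. Algorithm UCBid1 (parameter $\gamma>0$): $B_1=1$, and for $t\ge2$, $B_t=\max\{\operatorname{argmax}_{b\in[0,1]}(\hat V_t+\epsilon_t-b)F(b)\}$. Assumption 1: $F$ is continuously differentiable with density $f$ and strictly log-concave ($f/F$ strictly decreasing on $(0,1)$). Assumption 2: $F$ has density $f$ with $c_f<f(b)<C_f$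 for $b\in[b^*_{v,F}-\Delta,b^*_{v,F}+\Delta]$, and $\phi_F:b\mapsto b+F(b)/f(b)$ has derivative at most $\lambda$ on $[b^*_{v,F},b^*_{v,F}+\Delta]$. *)

(* Defs.v *)
From HB Require Import structures.
From mathcomp Require Import all_boot all_order all_algebra.
From mathcomp Require Import all_classical all_reals all_analysis.
Set Implicit Arguments. Unset Strict Implicit. Unset Printing Implicit Defensive.
Import Order.TTheory GRing.Theory Num.Theory.
Import numFieldNormedType.Exports.
Local Open Scope classical_set_scope.
Local Open Scope ring_scope.

Definition mutually_independent {d} {T : measurableType d} {R : realType}
  (P : probability T R) {I : eqType} (X : I -> T -> R) : Prop :=
  forall (s : seq I) (A : I -> set R), uniq s -> (forall i, measurable (A i)) ->
  P (\big[setI/setT]_(i <- s) (X i @^-1` A i)) =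
  (\prod_(i <- s) P (X i @^-1` A i))%E.

Definition U {R : realType} (v : R) (F : R -> R) (b : R) : R := (v - b) * F b.

Definition argmax01 {R : realType} (g : R -> R) : set R :=
  [set b | b \in `[0, 1] /\ forall b', b' \in `[0, 1] -> g b' <= g b].

Definition maxargmax01 {R : realType} (g : R -> R) : R := sup (argmax01 g).

Definition bstar {R : realType} (v : R) (F : R -> R) : R := maxargmax01 (U v F).

Definition Umax {R : realType} (v : R) (F : R -> R) : R := sup (U v F @` `[0, 1]).

(* bid of UCBid1 at round t (t >= 1) given N_t = n and
   S_t = sum_{s<t} V_s 1{M_s <= B_s} = s  (so hat V_t = s / n) *)
Definition ucb_bid {R : realType} (F : R -> R) (gamma : R) (t : nat) (n s : R) : R :=
  if (t <= 1)%N then 1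
  else maxargmax01 (fun b => (s / n + Num.sqrt (gamma * ln (t.-1%:R) / (2 * n)) - b) * F b).

(* ucb_stats k w = (N_{k+1}, S_{k+1}): statistics after rounds 1..k *)
Fixpoint ucb_stats {R : realType} {T : Type} (F : R -> R) (gamma : R)
  (V M : nat -> T -> R) (k : nat) (w : T) : R * R :=
  match k with
  | 0 => (0, 0)
  | k'.+1 =>
      let ns := ucb_stats F gamma V M k' w in
      let b := ucb_bid F gamma k'.+1 ns.1 ns.2 in
      if M k'.+1 w <= b then (ns.1 + 1, ns.2 + V k'.+1 w) else ns
  end.

Definition ucb_B {R : realType} {T : Type} (F : R -> R) (gamma : R)
  (V M : nat -> T -> R) (t : nat) (w : T) : R :=
  let ns := ucb_stats F gamma V M t.-1 w in ucb_bid F gamma t ns.1 ns.2.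

Definition regret {d} {T : measurableType d} {R : realType} (P : probability T R)
  (v : R) (F : R -> R) (gamma : R) (V M : nat -> T -> R) (TT : nat) : \bar R :=
  ((TT%:R * Umax v F)%:E -
   \sum_(1 <= t < TT.+1) \int[P]_w (U v F (ucb_B F gamma V M t w))%:E)%E.

(* Main.v *)
(* A round with statistics (N, S) is bad if |S / N - v| exceeds the confidence width eps.
   Write b0 = bstar v F. Outside bad rounds the bid B lies in [b0, b0 + 2 eps]: the maximiser of (u - b) F(b) is
   nondecreasing in u, and the first-order condition u = phi(b) with phi(b) - b increasing makes it
   1-Lipschitz. Since U' = f (v - phi), the gap is then at most C_f lambda (B - b0)^2 / 2, that is
   gamma lambda C_f log T / N, except when N = O(log T), where it is at most 2.
   As B >= b0, each such round is won with conditional probability at least F(b0), so the expected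
   sum of these bounds is at most 1 / F(b0) times the sum over won rounds, along which N runs
   through 1, 2, 3, ...: a harmonic sum.
   Bad rounds have probability O(1 / t), by applying Markov's inequality to the exponential
   supermartingale exp (l (S - v N) - N l^2 / 8) for O(log t) values of l, one per geometric slice
   of values of N (a union bound over N itself would require gamma >= 2).
   The leading constant obtained is smaller than the stated one by a factor 2 C_f / c_f. *)
Require Import Defs.
From HB Require Import structures.
From mathcomp Require Import all_boot all_order all_algebra.
From mathcomp Require Import all_classical all_reals all_analysis measurable_realfun.
From mathcomp Require Import ring lra.
Set Implicit Arguments. Unset Strict Implicit. Unset Printing Implicit Defensive.
Import Order.TTheory GRing.Theory Num.Theory.
Import numFieldNormedType.Exports.
Local Open Scope classical_set_scope.
Local Open Scope ring_scope.

(** * Real analysis *)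

Section real_lemmas.
Context {R : realType}.
Implicit Types x l v : R.

Lemma ge0_is_derive_ndecr (f df : R -> R) (a : R) :
  (forall x, a < x -> is_derive x 1 f (df x)) -> {within `[a, +oo[, continuous f} ->
  (forall x, a < x -> 0 <= df x) -> forall x, a <= x -> f a <= f x.
Proof.
move=> fdf cf df0 x; rewrite le_eqVlt => /predU1P[->//|ax].
have fd y : y \in `]a, x[ -> is_derive y 1 f (df y).
  by rewrite in_itv/= => /andP[ay _]; exact: fdf.
have cx : {within `[a, x], continuous f}.
  by apply: continuous_subspaceW cf => y /=; rewrite !in_itv/= => /andP[->].
have [c + e] := MVT ax fd cx.
rewrite in_itv/= => /andP[ac _].
by rewrite -subr_ge0 e mulr_ge0 ?df0// subr_ge0 ltW.
Qed.

(** Bernoulli case of Hoeffding's lemma. The difference [g] of the two exponents vanishes at 0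
    together with its derivative, and its second derivative [1/4 - p (1 - p)] is the square of
    [p - 1/2]. *)
Lemma hoeffding_ge0 v l : 0 <= v <= 1 -> 0 <= l ->
  1 - v + v * expR l <= expR (l * v + l ^+ 2 / 8).
Proof.
move=> /andP[v0 v1] l0.
have D0 y : 0 < 1 - v + v * expR y.
  have := expR_gt0 y; rewrite le_eqVlt in v0; case/orP: v0 => [/eqP <-|v0] ye; first lra.
  by have := mulr_gt0 v0 ye; lra.
(* [p y] is the mean of the Bernoulli law tilted by [expR y]. *)
pose p y : R := v * expR y / (1 - v + v * expR y).
pose g y := y * v + y ^+ 2 / 8 - ln (1 - v + v * expR y).
have dD (y : R) : is_derive y 1 (fun y : R => 1 - v + v * expR y) (v * expR y).
  apply: is_derive_eq.
  by rewrite /GRing.scale /= ; ring.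
have dg (y : R) : is_derive y 1 g (v + y / 4 - p y).
  have dl : is_derive y 1 (fun y : R => ln (1 - v + v * expR y)) (p y).
    have := @is_derive1_comp _ (@ln R) (fun y : R => 1 - v + v * expR y) y
      (1 - v + v * expR y)^-1 (v * expR y) (is_derive1_ln (D0 y)) (dD y).
    by move=> H; apply: (is_derive_eq H); rewrite /p; ring.
  apply: is_derive_eq.
  by rewrite /GRing.scale /=; field.
pose dgf y := v + y / 4 - p y.
have ddg (y : R) : is_derive y 1 dgf (4^-1 - p y * (1 - p y)).
  have dp : is_derive y 1 p (p y * (1 - p y)).
    have H := @is_deriveV R (fun y : R => 1 - v + v * expR y) y _ 1 (lt0r_neq0 (D0 y)) (dD y).
    have H2 : is_derive y 1 (fun y : R => v * expR y) (v * expR y).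
      by apply: is_derive_eq; rewrite /GRing.scale /=; ring.
    have H3 := is_deriveM H2 H.
    apply: (is_derive_eq H3).
    rewrite /p /GRing.scale /= ; field; exact: lt0r_neq0.
  apply: is_derive_eq.
  by rewrite /GRing.scale /=; field.
have cont (f df : R -> R) : (forall y : R, is_derive y 1 f (df y)) ->
    {within `[0, +oo[, continuous f}.
  move=> fd; apply: continuous_subspaceT => y.
  by apply: differentiable_continuous; apply/derivable1_diffP; case: (fd y).
have dg0 y : 0 <= y -> 0 <= dgf y.
  move=> y0; have := @ge0_is_derive_ndecr dgf _ 0 (fun x _ => ddg x) (cont _ _ ddg) _ y y0.
  have -> : dgf 0 = 0 by rewrite /dgf /p expR0; field; apply/eqP; lra.
  apply => x _; have := sqr_ge0 (p x - 2^-1); nra.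
have g0 : g 0 <= g l.
  apply: (@ge0_is_derive_ndecr g _ 0 (fun x _ => dg x) (cont _ _ dg)) => // x x0.
  exact/dg0/ltW.
rewrite -[leLHS](lnK (D0 l)) ler_expR -subr_ge0.
by move: g0; rewrite /g expR0 mul0r expr0n/= mul0r mulr1 subrK ln1 addr0 subr0.
Qed.

(** For negative [l], exchanging the two outcomes turns [v] into [1 - v] and [l] into [- l], up to a
    factor [expR l]. *)
Lemma hoeffding v l : 0 <= v <= 1 -> 1 - v + v * expR l <= expR (l * v + l ^+ 2 / 8).
Proof.
move=> v01; have [/hoeffding_ge0|l0] := leP 0 l; first exact.
have /hoeffding_ge0 : 0 <= 1 - v <= 1 by move: v01; lra.
move=> /(_ (- l)); rewrite oppr_ge0 (ltW l0) sqrrN => /(_ isT) H.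
have -> : l * v + l ^+ 2 / 8 = l + (- l * (1 - v) + l ^+ 2 / 8) by ring.
rewrite expRD; apply: le_trans (ler_wpM2l (expR_ge0 l) H).
by rewrite mulrDr mulrCA -expRD subrr expR0; lra.
Qed.

(* Both endpoints lie above the tangent of expR at [l * x]. *)
Lemma expR_chord x l : 0 <= x <= 1 -> expR (l * x) <= 1 - x + x * expR l.
Proof.
move=> /andP[x0 x1].
have tangent y : expR (l * x) * (1 + (y - l * x)) <= expR y.
  rewrite -[in leRHS](subrKC (l * x) y) expRD.
  by apply: ler_wpM2l (expR_ge1Dx _); exact: expR_ge0.
have := tangent 0; have := tangent l; rewrite expR0 => /(ler_wpM2l x0) t1.
have x1' : 0 <= 1 - x by rewrite subr_ge0.
move=> /(ler_wpM2l x1') t0.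
have := lerD t0 t1; rewrite mulr1; apply: le_trans.
by rewrite le_eqVlt; apply/orP; left; apply/eqP; ring.
Qed.

(** Each increment is [ln (1 + x) <= x] at [x = - 1 / (m + 2)]. For [m = 0] the conventional value
    [ln 0 = 0] is used. *)
Lemma harmonic_le m : \sum_(1 <= n < m.+1) (n%:R^-1 : R) <= 1 + ln m%:R.
Proof.
case: m => [|m]; first by rewrite big_geq// ln0// addr0.
elim: m => [|m ih]; first by rewrite big_nat1 invr1 ln1 addr0.
rewrite big_nat_recr//=.
have a : (0 : R) < m.+1%:R by rewrite ltr0n.
have b : (0 : R) < m.+2%:R by rewrite ltr0n.
have e : 1 - m.+2%:R^-1 = m.+1%:R / m.+2%:R :> R.
  by rewrite -[m.+2%:R]natr1; move: m.+1%:R a => x x0; field; apply/eqP; lra.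
have := @le_ln1Dx R (- m.+2%:R^-1); rewrite e ltrN2 invf_lt1// ltr1n => /(_ isT).
rewrite ln_div ?posrE//.
rewrite lerNr opprB lerBrDl => h.
by rewrite (le_trans (lerD ih (lexx _)))// -addrA lerD2l.
Qed.

Lemma sum_indicator_le (m : nat) x : 0 <= x ->
  \sum_(1 <= n < m.+1) ((n%:R <= x)%R%:R : R) <= x.
Proof.
move=> x0.
(* The bound by [m] is carried along because it is what the induction needs when the new term
   counts, that is when [m.+1 <= x]. *)
suff : \sum_(1 <= n < m.+1) ((n%:R <= x)%R%:R : R) <= x /\
  \sum_(1 <= n < m.+1) ((n%:R <= x)%R%:R : R) <= m%:R by case.
elim: m => [|m [ih1 ih2]]; first by rewrite big_geq.
rewrite big_nat_recr//=; case: (leP m.+1%:R x) => mx /=; last first.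
  by rewrite mulr0n addr0; split => //; rewrite (le_trans ih2)// ler_nat.
by rewrite mulr1n -natr1 lerD2r ih2; split => //; rewrite (le_trans _ mx)// -natr1 lerD2r.
Qed.

End real_lemmas.

(** * Geometric slicing of the number of wins *)

Section peeling.
Context {R : realType}.
Implicit Types (gamma delta L N D : R).

(* The Chernoff exponent tuned for the deviation [N * sqrt (gamma L / (2 N))] at [N = exp (2 k delta)]. *)
Definition peel_exponent gamma delta L (k : nat) : R :=
  4 * Num.sqrt (gamma * L / 2) / expR (k%:R * delta).

(** A slice has width [2 * delta] on the scale of [ln N], which ranges over [[0, L]]. *)
Definition peel_slices delta L := (Num.truncn (L / (2 * delta))).+1.

(* If [N] is in the [k]-th slice then [c := sqrt N / exp (k delta)] is in [1, exp delta] and the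
   exponent achieved is [gamma L (1 - (c - 1) ^ 2)]. *)
Lemma peel gamma : 1 < gamma -> exists delta gamma', [/\ 0 < delta, 1 < gamma' &
  forall L N D, 0 <= L -> 1 <= N -> ln N <= L ->
  Num.sqrt (gamma * L / (2 * N)) * N <= D ->
  exists2 k, (k < peel_slices delta L)%N &
    gamma' * L <= peel_exponent gamma delta L k * D -
      N * peel_exponent gamma delta L k ^+ 2 / 8].
Proof.
move=> g1; have g0 : 0 < gamma by lra.
have gi : gamma * gamma^-1 = 1 by rewrite divff ?gt_eqF.
have gV1 : gamma^-1 < 1 by rewrite invf_lt1.
have gV0 : 0 < gamma^-1 by rewrite invr_gt0.
(* Slicing [sqrt N] with ratio [1 + eta] costs a factor [1 - eta ^ 2]; this [eta] is small enough
   for [gamma (1 - eta ^ 2)] to stay above 1. *)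
pose eta := (1 - gamma^-1) / 2.
have eta0 : 0 < eta by rewrite /eta; lra.
have eta1 : 0 < 1 + eta by lra.
exists (ln (1 + eta)), (gamma * (1 - eta ^+ 2)); split.
- by rewrite ln_gt0//; lra.
- have e2 : eta ^+ 2 < 1 - gamma^-1 by rewrite /eta; nra.
  have := ltr_pM2l g0 (gamma^-1) (1 - eta ^+ 2); rewrite gi => ->; lra.
move=> L N D L0 N1 NL hD.
set delta := ln (1 + eta).
have delta0 : 0 < delta by rewrite ln_gt0//; lra.
have N0 : 0 < N by lra.
have lnN0 : 0 <= ln N by rewrite ln_ge0.
(* [x] is the logarithm of [sqrt N] in units of [delta]; its integer part is the slice. *)
pose x := ln N / (2 * delta).
have x0 : 0 <= x by rewrite divr_ge0// mulr_ge0// ltW.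
have d2 : 0 < 2 * delta by lra.
exists (Num.truncn x).
  rewrite ltnS; apply: le_truncn; rewrite ler_pM2r// invr_gt0//.
have /andP[k1 k2] := truncn_itv x0.
set k := Num.truncn x in k1 k2 *.
rewrite /peel_exponent.
set a := Num.sqrt (gamma * L / 2).
set p := expR (k%:R * delta).
set q := Num.sqrt N.
have p0 : 0 < p by exact: expR_gt0.
have q0 : 0 < q by rewrite sqrtr_gt0.
have q2 : q ^+ 2 = N by rewrite sqr_sqrtr// ltW.
have a0 : 0 <= a by exact: sqrtr_ge0.
have a2 : a ^+ 2 = gamma * L / 2.
  by rewrite sqr_sqrtr// divr_ge0// mulr_ge0// ltW.
have lnNE : ln N = x * (2 * delta) by rewrite /x divfK// gt_eqF.
have qE : q = expR (x * delta).
  rewrite /q -[N in LHS](@lnK _ N)// lnNE mulrCA.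
  by rewrite expRM_natl sqrtr_sqr ger0_norm// expR_ge0.
have pq : p <= q by rewrite qE ler_expR ler_wpM2r// ltW.
have qp : q <= (1 + eta) * p.
  rewrite -[1 + eta](@lnK _ (1 + eta))// -expRD qE ler_expR.
  by rewrite -/delta; have := ltW k2; rewrite -natr1; nra.
have epsE : Num.sqrt (gamma * L / (2 * N)) * N = a * q.
  rewrite invfM mulrA sqrtrM; last by rewrite divr_ge0// mulr_ge0// ltW.
  rewrite -/a -mulrA sqrtrV ?(ltW N0)// -/q -{1}q2 expr2 mulKf ?gt_eqF//.
have [c1 c2] : 1 <= q / p /\ q / p <= 1 + eta.
  by split; [rewrite ler_pdivlMr ?mul1r|rewrite ler_pdivrMr].
rewrite epsE in hD.
have h : 4 * a / p * (a * q) <= 4 * a / p * D.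
  by apply: ler_wpM2l => //; rewrite divr_ge0 ?mulr_ge0// ltW.
have -> : N * (4 * a / p) ^+ 2 / 8 = 2 * a ^+ 2 * (q / p) ^+ 2.
  by rewrite -q2; field; exact: lt0r_neq0.
have e : 4 * a / p * (a * q) = 4 * a ^+ 2 * (q / p) by field; exact: lt0r_neq0.
rewrite e a2 in h.
apply: le_trans (lerB h (lexx _)); rewrite a2.
have gL : 0 <= gamma * L by rewrite mulr_ge0// ltW.
move: (q / p) c1 c2 => c c1 c2.
have : (c - 1) ^+ 2 <= eta ^+ 2 by rewrite ler_sqr ?nnegrE; lra.
move=> /(ler_wpM2l gL); lra.
Qed.

(** The number of slices is affine in [L], so the spare factor [expR (- (gamma' - 1) L)] absorbs it.
    At [L = ln k] the bound is [C / k]. *)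
Lemma peel_slices_le delta gamma' : 0 < delta -> 1 < gamma' -> exists2 C : R, 0 <= C &
  forall L, 0 <= L -> (peel_slices delta L)%:R * expR (- (gamma' * L)) <= C * expR (- L).
Proof.
move=> d0 g1; have g0 : 0 < gamma' - 1 by lra.
have C0 : 0 <= (2 * delta * (gamma' - 1))^-1 by rewrite invr_ge0 !mulr_ge0// ltW.
exists (1 + (2 * delta * (gamma' - 1))^-1) => [|L L0]; first lra.
have -> : - (gamma' * L) = - ((gamma' - 1) * L) - L by ring.
rewrite expRD mulrA ler_wpM2r ?expR_ge0//.
rewrite expRN ler_pdivrMr ?expR_gt0//.
have x0 : 0 <= L / (2 * delta) by rewrite divr_ge0// mulr_ge0// ltW.
have /andP[k1 _] := truncn_itv x0.
have e1 : 1 + (gamma' - 1) * L <= expR ((gamma' - 1) * L) := expR_ge1Dx _.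
have gL : 0 <= (gamma' - 1) * L by rewrite mulr_ge0// ltW.
apply: (@le_trans _ _ (1 + L / (2 * delta))).
  by rewrite /peel_slices -natr1 addrC lerD2l.
have -> : L / (2 * delta) = (2 * delta * (gamma' - 1))^-1 * ((gamma' - 1) * L).
  by field; rewrite !gt_eqF//.
rewrite [leRHS]mulrDl mul1r; apply: lerD; first by lra.
by apply: ler_wpM2l => //; lra.
Qed.

End peeling.

(** * Optimal bids *)

Section argmax.
Context {R : realType}.
Implicit Types (g F : R -> R) (u : R).

(** Maximisers exist by compactness. If their supremum were not one, continuity would keep [g] below
    its maximum near the supremum, where there are maximisers. *)
Lemma argmax01_maxargmax01 g : {within `[0, 1], continuous g} ->
  argmax01 g (maxargmax01 g).
Proof.
move=> cg; have [c c01 cmax] := EVT_max ler01 cg.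
have Ac : argmax01 g c by [].
have ubA : ubound (argmax01 g) 1 by move=> x [+ _]; rewrite in_itv/= => /andP[].
have supA : has_sup (argmax01 g) by split; [exists c|exists 1].
have s01 : maxargmax01 g \in `[0, 1].
  rewrite in_itv/=; apply/andP; split; last by apply: ge_sup => //; exists c.
  apply: le_trans (ub_le_sup supA.2 Ac).
  by move: c01; rewrite in_itv/= => /andP[].
split=> // b b01; apply: le_trans (cmax _ b01) _; rewrite leNgt; apply/negP => sc.
have : g y @[y --> within `[0, 1] (nbhs (maxargmax01 g))] --> g (maxargmax01 g).
  by move/subspace_continuousP : cg; apply.
move=> /cvgr_lt /(_ _ sc); rewrite near_withinE => /nbhs_ballP[e /= e0 He].
have [a Aa sa] := sup_adherent e0 supA.
have : g a < g c.
  apply: He; last by case: Aa.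
  rewrite /ball/= ger0_norm ?subr_ge0; last exact: ub_le_sup supA.2 _ Aa.
  by rewrite ltrBlDl -ltrBlDr.
by rewrite ltNge; case: Aa => _ /(_ _ c01) ->.
Qed.

Lemma le_maxargmax01 g b : argmax01 g b -> b <= maxargmax01 g.
Proof.
move=> Ab; apply: ub_le_sup => //.
by exists 1 => x [+ _]; rewrite in_itv/= => /andP[].
Qed.

Lemma continuous_utility F u (a b : R) : {within `[a, b], continuous F} ->
  {within `[a, b], continuous (fun x => (u - x) * F x)}.
Proof.
move=> cF; have cu : {within `[a, b], continuous (fun x : R => u - x)}.
  by apply: continuous_subspaceT => x; apply: cvgB; [exact: cvg_cst|exact: cvg_id].
by move=> x; exact: cvgM (cu x) (cF x).
Qed.

Arguments continuous_utility {F} u {a b}.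

(** Exchange argument: suppose the larger value [u'] had a bid [b' < b]. Adding
    [(u' - u) (F b - F b') >= 0] to the optimality of [b] at [u] makes [b] optimal at [u'] too,
    although [b'] is the largest maximiser there. *)
Lemma maxargmax01_homo F : {homo F : x y / x <= y} ->
  {within `[0, 1], continuous F} ->
  {homo (fun u => maxargmax01 (fun b => (u - b) * F b)) : x y / x <= y}.
Proof.
move=> Fnd cF u u' uu'; rewrite leNgt; apply/negP => lt.
have [b01 bmax] := argmax01_maxargmax01 (continuous_utility u cF).
have [b01' bmax'] := argmax01_maxargmax01 (continuous_utility u' cF).
have := bmax _ b01'.
set b := maxargmax01 (fun b => (u - b) * F b) in lt b01 bmax *.
set b' := maxargmax01 (fun b => (u' - b) * F b) in lt b01' bmax' * => bb.
suff /le_maxargmax01 : argmax01 (fun b => (u' - b) * F b) b.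
  by rewrite -/b' leNgt lt.
split=> // x x01; apply: le_trans (bmax' _ x01) _.
have := Fnd _ _ (ltW lt) => Fb.
have := mulr_ge0 (ltac:(rewrite subr_ge0; exact: uu') : 0 <= u' - u)
  (ltac:(rewrite subr_ge0; exact: Fb) : 0 <= F b - F b').
by move: bb; rewrite /=; lra.
Qed.

Lemma Umax_argmax v F b : argmax01 (U v F) b -> Umax v F = U v F b.
Proof.
move=> [b01 bmax]; apply/eqP; rewrite eq_le; apply/andP; split.
  by apply: ge_sup => [|_ [x x01 <-]]; [exists (U v F b); exists b|exact: bmax].
apply: ub_le_sup; last by exists b.
by exists (U v F b) => _ [x x01 <-]; exact: bmax.
Qed.

End argmax.

(** * First-order analysis of the utility near the optimal bid *)

Section log_concave_cdf.
Context {R : realType} (F f : R -> R).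
Hypothesis Fnd : {homo F : x y / x <= y}.
Hypothesis F01 : forall x, 0 <= F x <= 1.
Hypothesis cF : {within `[0, 1], continuous F}.
Hypothesis F1 : F 1 = 1.
Hypothesis F_lt0 : forall x, x < 0 -> F x = 0.
Hypothesis dF : forall b, b \in `]0, 1[ -> derivable F b 1 /\ derive1 F b = f b.
Hypothesis slc : {in `]0, 1[ &, forall x y, x < y -> f y / F y < f x / F x}.

(** If [F y = 0] inside the unit interval, [F] also vanishes at [y / 2]. Division by zero then gives
    [f / F] the value 0 at both points, against its strict decrease. *)
Lemma cdf_gt0 (x : R) : 0 < x -> 0 < F x.
Proof.
move=> x0; suff H y : y \in `]0, 1[ -> 0 < F y.
  have [x1|x1] := ltP x 1; first by apply: H; rewrite in_itv/= x0.
  by apply: lt_le_trans (Fnd x1); rewrite F1.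
rewrite in_itv/= => /andP[y0 y1]; have [//|] := ltP 0 (F y) => Fy.
have Fz z : z <= y -> F z = 0.
  by move=> zy; apply/eqP; rewrite eq_le (le_trans (Fnd zy))//=; case/andP: (F01 z).
have := slc (x := y / 2) (y := y) _ _ _.
rewrite !Fz//; last by lra.
rewrite invr0 !mulr0 ltxx !in_itv/= => H.
by suff : false by []; apply: H; lra.
Qed.

Lemma is_derive_utility u (b : R) : b \in `]0, 1[ ->
  is_derive b 1 (fun x => (u - x) * F x) ((u - b) * f b - F b).
Proof.
move=> /dF[dFb Fb].
have H : is_derive b 1 F (f b) by split => //; rewrite -Fb derive1E.
have H2 : is_derive b 1 (fun x : R => u - x) (-1).
  by apply: is_derive_eq; rewrite /GRing.scale /=; ring.
apply: (is_derive_eq (is_deriveM H2 H)).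
by rewrite /GRing.scale /=; ring.
Qed.

Context (v Delta c_f C_f lambda : R).
Let b0 := bstar v F.
Hypothesis v01 : 0 <= v <= 1.
Hypothesis Delta_gt0 : 0 < Delta.
Hypothesis c_f_gt0 : 0 < c_f.
Hypothesis f_bounds :
  forall b, b \in `[b0 - Delta, b0 + Delta] -> c_f < f b < C_f.
Hypothesis phi' : forall b, b \in `[b0, b0 + Delta] ->
     derivable (fun x => x + F x / f x) b 1 /\
     derive1 (fun x => x + F x / f x) b <= lambda.
Hypothesis Fb0 : 0 < F b0.

Let bid u := maxargmax01 (fun b => (u - b) * F b).

Let bid_argmax u : argmax01 (fun b => (u - b) * F b) (bid u).
Proof. exact/argmax01_maxargmax01/continuous_utility. Qed.

Let b0_argmax : argmax01 (U v F) b0.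
Proof. exact: bid_argmax. Qed.

(** The bid 1 earns [v - 1]. To match the bid 0 it needs [v = 1], and then the bid 1/2 earns
    strictly more. *)
Lemma bstar_lt1 : b0 < 1.
Proof.
have [+ bmax] := b0_argmax; rewrite in_itv/= => /andP[b0_ge0].
rewrite le_eqVlt => /predU1P[b1|//].
have H x : 0 <= x <= 1 -> (v - x) * F x <= v - 1.
  by move=> x01; have := bmax x x01; rewrite /U b1 F1 mulr1.
have H0 := H 0 ltac:(lra); have Hh := H (2^-1) ltac:(lra).
have F0 : 0 <= F 0 by case/andP: (F01 0).
have Fh : 0 < F 2^-1 by apply: cdf_gt0; lra.
case/andP: v01 => v0 v1.
have := mulr_ge0 v0 F0; have v1' : v = 1 by nra.
by move: Hh; rewrite v1'; nra.
Qed.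

Let phi (x : R) := x + F x / f x.

Let continuous_phi (b : R) : b \in `[b0, b0 + Delta] -> {for b, continuous phi}.
Proof.
by move=> /phi'[/derivable1_diffP/differentiable_continuous].
Qed.

Let f_gt0 b : b0 <= b <= b0 + Delta -> 0 < f b < C_f.
Proof.
move=> /andP[h1 h2]; have /andP[+ ->] : c_f < f b < C_f.
  by apply: f_bounds; rewrite in_itv/= h2 andbT; move: Delta_gt0; lra.
by rewrite andbT; apply: lt_trans.
Qed.

Let b0_near : b0 <= b0 <= b0 + Delta.
Proof. by rewrite lexx lerDl ltW. Qed.

(* Left of 0 the map phi is the identity, so it would jump at b0 = 0. *)
Lemma bstar_gt0 : 0 < b0.
Proof.
have [+ _] := b0_argmax; rewrite in_itv/= => /andP[+ _].
rewrite le_eqVlt => /predU1P[/esym b00|//].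
have b0D : b0 \in `[b0, b0 + Delta] by rewrite in_itv/= lexx lerDl ltW.
have phi0 : 0 < phi b0.
  rewrite /phi [X in X + _]b00 add0r divr_gt0//.
  by have /andP[] := f_gt0 b0_near.
have := continuous_phi b0D => /cvgr_gt /(_ _ phi0) /nbhs_ballP[e /= e0 He].
have := He (b0 - e / 2).
rewrite /ball/= opprB addrC subrK ger0_norm; last lra.
rewrite b00 add0r /phi F_lt0; last lra.
by rewrite mul0r addr0 => /(_ ltac:(lra)); lra.
Qed.

Let b0_in : b0 \in `]0, 1[.
Proof. by rewrite in_itv/= bstar_gt0 bstar_lt1. Qed.

Let bstar_foc : (v - b0) * f b0 = F b0.
Proof.
have [_ bmax] := b0_argmax.
have H : is_derive b0 1 (U v F) 0.
  apply: (derive1_at_max ler01 _ b0_in) => t t01.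
    by have [] := is_derive_utility v t01.
  by apply: bmax; exact: subset_itv_oo_cc.
have := is_derive_utility v b0_in => H'.
have := @derive_val _ _ _ _ _ _ _ H; have := @derive_val _ _ _ _ _ _ _ H'.
by move=> -> /eqP; rewrite subr_eq0 => /eqP.
Qed.

Let f_b0_gt0 : 0 < f b0.
Proof. by have /andP[] := f_gt0 b0_near. Qed.

Let phi_b0 : phi b0 = v.
Proof. by rewrite /phi -bstar_foc mulfK ?gt_eqF// addrC subrK. Qed.

Lemma bid_ge_bstar u : v <= u -> b0 <= bid u.
Proof. exact: (maxargmax01_homo Fnd cF). Qed.

(** The bid [b] may be 1, where no first-order condition is at hand. If [b] were too large, the mean
    value theorem just left of it would give [c > b0 + (u - v)] with [F c <= (u - c) f c]. As
    [f / F] decreases, [(v - b0) f b0 = F b0 <= (u - c) f b0], so [c <= b0 + (u - v)], a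
    contradiction. *)
Lemma bid_le_bstar u : v <= u -> bid u <= b0 + (u - v).
Proof.
move=> vu; have b0b := bid_ge_bstar vu.
have [b01 bmax] := bid_argmax u; set b := bid u in b0b b01 bmax *.
move: b01; rewrite in_itv/= => /andP[b_ge0 b_le1].
rewrite leNgt; apply/negP => lt.
pose x := (b + (b0 + (u - v))) / 2.
have [x1 x2] : b0 + (u - v) < x /\ x < b by rewrite /x; split; lra.
have b00 := bstar_gt0.
have in01 y : x < y -> y < b -> y \in `]0, 1[ by move=> *; rewrite in_itv/=; lra.
have sub (y : R) : y \in `]x, b[ -> is_derive y 1 (fun x => (u - x) * F x) ((u - y) * f y - F y).
  by rewrite in_itv/= => /andP[y1 y2]; exact/is_derive_utility/in01.
have cxb : {within `[x, b], continuous (fun x => (u - x) * F x)}.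
  apply: continuous_utility; apply: continuous_subspaceW cF => y /=.
  by rewrite !in_itv/=; lra.
have [c + e] := MVT x2 sub cxb; rewrite in_itv/= => /andP[xc cb].
have x01 : x \in `[0, 1] by rewrite in_itv/=; lra.
have c01 := in01 _ xc cb.
have : 0 <= (u - c) * f c - F c.
  by move: e (bmax _ x01) => /=; nra.
rewrite subr_ge0 => Fc.
have Fb : 0 < F b by apply: cdf_gt0; lra.
(* The bid [b0] has nonnegative utility at [u], hence so has the optimal bid. This fixes the sign of
   [u - c] below. *)
have ub : 0 <= u - b.
  have b001 : b0 \in `[0, 1] by apply: subset_itv_oo_cc.
  have := bmax _ b001 => /=.
  have : 0 <= v - b0.
    by rewrite -(pmulr_lge0 _ f_b0_gt0) bstar_foc ltW.
  move=> h1 h2; rewrite -(pmulr_lge0 _ Fb); apply: le_trans h2.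
  by apply: mulr_ge0; [lra|exact: ltW].
have cgt0 : 0 < F c by apply: cdf_gt0; lra.
have uc : 0 < u - c by lra.
have := slc (x := b0) (y := c) b0_in c01 ltac:(lra).
rewrite ltr_pdivrMr// mulrAC ltr_pdivlMr// => h.
have h1 := ler_wpM2r (ltW Fb0) Fc.
have h2 : (u - c) * f c * F b0 <= (u - c) * f b0 * F c.
  by rewrite -!mulrA; apply: ler_wpM2l; exact: ltW.
have := le_trans h1 h2.
rewrite mulrC ler_pM2r// -bstar_foc ler_pM2r//; lra.
Qed.

(** Below, [F / f] increases as the inverse of [f / F]; above, the mean value theorem applies with
    slope at most [lambda]. *)
Let phi_bounds x : b0 <= x <= b0 + Delta -> x < 1 -> 0 <= phi x - v <= lambda * (x - b0).
Proof.
rewrite le_eqVlt andb_orl => /orP[/andP[/eqP <- _] _|/andP[b0x xD] x1].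
  by rewrite phi_b0 !subrr mulr0 lexx.
rewrite -phi_b0; apply/andP; split.
  rewrite subr_ge0 /phi; apply: lerD; first exact: ltW.
  have x0 : 0 < x by apply: lt_trans b0x; exact: bstar_gt0.
  have x01 : x \in `]0, 1[ by rewrite in_itv/= x0.
  have /andP[fx _] := f_gt0 (b := x) ltac:(by rewrite (ltW b0x)).
  have := slc b0_in x01 b0x.
  have Fx := cdf_gt0 x0.
  rewrite -[leLHS]invf_div -[leRHS]invf_div => h.
  by rewrite lef_pV2 ?posrE ?divr_gt0// ltW.
have inD y : b0 <= y <= x -> y \in `[b0, b0 + Delta].
  by rewrite in_itv/= => /andP[-> /le_trans ->].
have dphi (y : R) : y \in `]b0, x[ -> is_derive y 1 phi (derive1 phi y).
  rewrite in_itv/= => /andP[y1 y2].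
  have /phi'[? _] := inD y ltac:(by rewrite !ltW).
  by split => //; rewrite derive1E.
have cphi : {within `[b0, x], continuous phi}.
  apply: continuous_in_subspaceT => y; rewrite inE/= in_itv/= => yx.
  exact/continuous_phi/inD.
have [c + ->] := MVT b0x dphi cphi; rewrite in_itv/= => /andP[c1 c2].
rewrite ler_pM2r ?subr_gt0//.
by have /phi'[] := inD c ltac:(by rewrite !ltW).
Qed.

(** [phi_bounds] gives [0 <= lambda * m] at a point [b0 + m], where [m > 0] is small enough to stay
    within [Delta] and below 1. *)
Lemma lambda_ge0 : 0 <= lambda.
Proof.
have h := bstar_lt1.
pose m := Num.min Delta (1 - b0) / 2.
have m0 : 0 < m by rewrite divr_gt0// lt_min Delta_gt0 subr_gt0.
have mD : 2 * m <= Delta by rewrite /m mulrC divfK// ge_min lexx.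
have m1 : 2 * m <= 1 - b0 by rewrite /m mulrC divfK// ge_min lexx orbT.
have := phi_bounds (x := b0 + m) ltac:(lra) ltac:(lra).
move=> /andP[h1 h2]; have := le_trans h1 h2.
by rewrite addrC addKr pmulr_lge0.
Qed.

Lemma C_f_gt0 : 0 < C_f.
Proof.
have /andP[] := f_gt0 b0_near.
exact: lt_trans.
Qed.

(** [H] adds the claimed quadratic bound to the utility. Its derivative
    [C_f lambda (x - b0) - f (phi - v)] is nonnegative by [f < C_f] and [phi_bounds]. *)
Lemma utility_gap b : b0 <= b <= b0 + Delta -> b <= 1 ->
  U v F b0 - U v F b <= C_f * lambda * (b - b0) ^+ 2 / 2.
Proof.
rewrite le_eqVlt andb_orl => /orP[/andP[/eqP <- _] _|/andP[b0b bD] b1].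
  by rewrite !subrr expr0n/= mulr0 mul0r.
pose H x := U v F x + C_f * lambda / 2 * (x - b0) ^+ 2.
have dH (x : R) : x \in `]b0, b[ ->
    is_derive x 1 H ((v - x) * f x - F x + C_f * lambda * (x - b0)).
  rewrite in_itv/= => /andP[x1 x2].
  have x01 : x \in `]0, 1[.
    by rewrite in_itv/= (lt_trans bstar_gt0 x1) (lt_le_trans x2 b1).
  have h1 := is_derive_utility v x01.
  have h2 : is_derive x 1 (fun x : R => C_f * lambda / 2 * (x - b0) ^+ 2)
      (C_f * lambda * (x - b0)).
    by apply: is_derive_eq; rewrite /GRing.scale /=; field.
  exact: is_deriveD h1 h2.
have cq : {within `[b0, b], continuous (fun x : R => C_f * lambda / 2 * (x - b0) ^+ 2)}.
  apply: continuous_subspaceT => x; apply: cvgM; first exact: cvg_cst.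
  rewrite expr2; under eq_cvg do rewrite expr2.
  by apply: cvgM; apply: cvgB; (exact: cvg_id || exact: cvg_cst).
have cU : {within `[b0, b], continuous (U v F)}.
  rewrite [U v F](_ : _ = fun x => (v - x) * F x)//.
  apply: continuous_utility; apply: continuous_subspaceW cF => y /=.
  rewrite !in_itv/= => /andP[y1 y2].
  by rewrite (le_trans (ltW bstar_gt0) y1) (le_trans y2 b1).
have cH : {within `[b0, b], continuous H} by move=> x; exact: cvgD (cU x) (cq x).
have [c + e] := MVT b0b dH cH; rewrite in_itv/= => /andP[c1 c2].
have cD : b0 <= c <= b0 + Delta by rewrite (ltW c1) (le_trans (ltW c2) bD).
have /andP[p0 p1] := phi_bounds cD (lt_le_trans c2 b1).
have /andP[fc0 fc1] := f_gt0 cD.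
have fphi : (v - c) * f c - F c = - (f c * (phi c - v)).
  by rewrite /phi; field; exact: lt0r_neq0.
have : 0 <= H b - H b0.
  rewrite e mulr_ge0//; last by rewrite subr_ge0 ltW.
  rewrite fphi addrC subr_ge0 -mulrA.
  by apply: ler_pM => //; exact: ltW.
by rewrite /H subrr expr0n/= mulr0 addr0; lra.
Qed.

End log_concave_cdf.

(** * Independence *)

Section independence.
Context d (T : measurableType d) (R : realType) (P : probability T R).
Context (I : eqType) (X : I -> T -> R).

(** A pi-system generating the joint sigma-algebra of the variables listed in [s]. *)
Definition cylinders (s : seq I) : set (set T) :=
  [set E | exists2 A : I -> set R, (forall i, measurable (A i)) &
     E = \big[setI/setT]_(i <- s) (X i @^-1` A i)].

Lemma cylinders_setI_closed s : setI_closed (cylinders s).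
Proof.
move=> _ _ [A mA ->] [B mB ->]; exists (fun i => A i `&` B i).
  by move=> i; exact: measurableI.
by rewrite -big_split.
Qed.

Lemma measurable_cylinders s i : i \in s ->
  measurable_fun (T := g_sigma_algebraType (cylinders s)) setT (X i).
Proof.
move=> si _ B mB; rewrite setTI; apply: sub_sigma_algebra.
exists (fun k => if k == i then B else setT).
  by move=> k; case: ifP => // _; exact: measurableT.
apply/seteqP; split => w /=.
  move=> Bw; elim/big_rec: _ => // k E _ Ew; split => //=.
  by case: ifP => // /eqP ->.
by rewrite (big_rem _ si)/= eqxx => -[].
Qed.

Hypothesis mX : forall i, measurable_fun setT (X i).

Lemma cylinders_measurable s : cylinders s `<=` measurable.
Proof.
move=> _ [A mA ->]; elim/big_ind: _ => //.
- by move=> E F mE mF; exact: measurableI.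
- by move=> i _; rewrite -[_ @^-1` _]setTI; exact: mX.
Qed.

Lemma g_cylinders_measurable s E : <<s cylinders s >> E -> measurable E.
Proof.
apply: smallest_sub; last exact: cylinders_measurable.
exact: sigma_algebra_measurable.
Qed.

Lemma measurable_fun_cylinders s d' (T' : measurableType d') (Y : T -> T') :
  measurable_fun (T := g_sigma_algebraType (cylinders s)) setT Y ->
  measurable_fun setT Y.
Proof.
move=> mY _ B mB; apply: (@g_cylinders_measurable s).
by have := mY measurableT B mB; rewrite setTI.
Qed.

Hypothesis indepX : mutually_independent P X.

(** Both sides are finite measures in [E] that agree on the pi-system of cylinders, hence on the
    sigma-algebra it generates. *)
Lemma indep_cylinders s j E B : uniq s -> j \notin s -> measurable B ->
  <<s cylinders s >> E ->
  P (E `&` X j @^-1` B) = (P E * P (X j @^-1` B))%E.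
Proof.
move=> us js mB sE.
have mXB : measurable (X j @^-1` B) by rewrite -[_ @^-1` _]setTI; exact: mX.
have cT : cylinders s setT.
  by exists (fun=> setT) => //; rewrite big1// => i _; rewrite preimage_setT.
pose k : {nonneg R} := NngNum (fine_ge0 (measure_ge0 P (X j @^-1` B))).
have kE : (k%:num)%:E = P (X j @^-1` B).
  by rewrite /= fineK// fin_num_measure.
have := @g_sigma_algebra_measure_unique _ R T (cylinders s)
  (@cylinders_measurable s) (fun=> setT) (fun=> cT) _
  (mrestr P mXB) (mscale k P) (@cylinders_setI_closed s) _ _ E sE.
move=> H; transitivity (mscale k P E); last by rewrite /mscale/= kE muleC.
apply: H.
- by rewrite bigcup_const.
- move=> _ [A mA ->]; set E' := \big[_/_]_(_ <- _) _.
  transitivity (P (X j @^-1` B) * P E')%E; last by rewrite -kE.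
  rewrite /mrestr {}/E'.
  (* The event on [X j] becomes one more coordinate of the cylinder, free because [j] is not in
     [s]. *)
  have := @indepX (j :: s) (fun i => if i == j then B else A i) _ _.
  rewrite big_cons eqxx big_cons eqxx.
  have e i : i \in s -> (i == j) = false.
    by move=> si; apply: contraNF js => /eqP <-.
  rewrite (@eq_big_seq _ _ _ _ s _ (fun i => X i @^-1` A i)); last first.
    by move=> i /e ->.
  rewrite (@eq_big_seq _ _ _ _ s (fun i => P _) (fun i => P (X i @^-1` A i))); last first.
    by move=> i /e ->.
  rewrite setIC => H; etransitivity; first apply: H.
  - by rewrite /= js.
  - by move=> i; case: ifP.
  - by rewrite indepX.
- move=> _; change (P (setT `&` X j @^-1` B) < +oo)%E; rewrite setTI; apply: le_lt_trans (probability_le1 P mXB) _.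
  exact: ltry.
Qed.

(** The law of the pair [(Y, X j)] is the product of the two laws, so Tonelli's theorem factors the
    integral. *)
Lemma ge0_expectation_indep s j (Y : T -> R) (h : R -> R) :
  uniq s -> j \notin s ->
  measurable_fun (T := g_sigma_algebraType (cylinders s)) setT Y ->
  measurable_fun setT h -> (forall w, 0 <= Y w) -> (forall x, 0 <= h x) ->
  (\int[P]_w (Y w * h (X j w))%:E =
   \int[P]_w (Y w)%:E * \int[P]_w (h (X j w))%:E)%E.
Proof.
move=> us js mYs mh Y0 h0.
have mY := @measurable_fun_cylinders s _ _ _ mYs.
pose Z w := (Y w, X j w).
have mZ : measurable_fun setT Z by exact: measurable_fun_pair.
pose PY : probability _ R := distribution P (HB.pack Y (isMeasurableFun.Build _ _ _ _ _ mY) : {mfun T >-> R}).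
pose PX : probability _ R := distribution P (HB.pack (X j) (isMeasurableFun.Build _ _ _ _ _ (mX j)) : {mfun T >-> R}).
pose PZ : probability _ R := distribution P (HB.pack Z (isMeasurableFun.Build _ _ _ _ _ mZ) : {mfun T >-> (R * R)%type}).
have ZE A : measurable A -> (PY \x PX)%E A = PZ A.
  apply: product_measure_unique => A' B mA mB.
  rewrite /PZ /PY /PX /distribution /pushforward /=.
  rewrite -(@indep_cylinders s)//.
  by have := mYs measurableT A' mA; rewrite setTI.
(* The truncation makes the integrand nonnegative on the whole plane and changes nothing on the
   range of [Y]. *)
pose f (z : R * R) : \bar R := (Num.max z.1 0 * h z.2)%:E.
have mf' : measurable_fun (T := (R * R)%type) (U := \bar R) setT f.
  apply/measurable_EFinP; apply: measurable_funM => //.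
    by apply: measurable_maxr => //.
  exact: measurableT_comp.
have f0 z : (0 <= f z)%E by rewrite lee_fin mulr_ge0// le_max lexx orbT.
transitivity (\int[PZ]_z f z)%E.
  rewrite ge0_integral_distribution//; apply: eq_integral => w _ /=.
  by rewrite /f /Z /= max_l.
transitivity (\int[(PY \x PX)%E]_z f z)%E.
  by apply: eq_measure_integral => A mA _; exact/esym/ZE.
rewrite fubini_tonelli1//.
transitivity (\int[PY]_y ((Num.max y 0)%:E * \int[PX]_x (h x)%:E))%E.
  apply: eq_integral => y _; rewrite /fubini_F /f /=.
  under eq_integral do rewrite EFinM.
  rewrite ge0_integralZl_EFin//; last by rewrite le_max lexx orbT.
  - by move=> x _; rewrite lee_fin.
  - exact/measurable_EFinP.
rewrite ge0_integralZr//; last 3 first.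
- by apply/measurable_EFinP; apply: measurable_maxr.
- by move=> x _; rewrite lee_fin le_max lexx orbT.
- by apply: integral_ge0 => x _; rewrite lee_fin.
congr (_ * _)%E.
  rewrite ge0_integral_distribution//; last 2 first.
  - by apply/measurable_EFinP; apply: measurable_maxr.
  - by move=> x; rewrite lee_fin le_max lexx orbT.
  by apply: eq_integral => w _ /=; rewrite max_l.
rewrite ge0_integral_distribution//; exact/measurable_EFinP.
Qed.

End independence.

(** * UCBid1 *)

Section ucb_pathwise.
Context {R : realType} {T : Type} (F : R -> R) (gamma : R) (V M : nat -> T -> R).
Hypothesis M01 : forall t w, 0 <= M t w <= 1.

Local Notation stats := (ucb_stats F gamma V M).
Local Notation B := (ucb_B F gamma V M).

Definition ucb_win (k : nat) (w : T) : bool := M k w <= B k w.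

(** The count [N] at the start of round [k.+1], as a natural number so that it can bound a sum. *)
Definition ucb_wins (k : nat) (w : T) : nat := \sum_(1 <= j < k.+1) ucb_win j w.

Lemma ucb_statsS k w : stats k.+1 w =
  if ucb_win k.+1 w then ((stats k w).1 + 1, (stats k w).2 + V k.+1 w) else stats k w.
Proof. by []. Qed.

Lemma ucb_winsS k w : ucb_wins k.+1 w = (ucb_wins k w + ucb_win k.+1 w)%N.
Proof. by rewrite /ucb_wins big_nat_recr. Qed.

Lemma ucb_stats1 k w : (stats k w).1 = (ucb_wins k w)%:R.
Proof.
elim: k => [|k ih]; first by rewrite /ucb_wins big_geq.
rewrite ucb_statsS ucb_winsS; case: ifP => _ /=; first by rewrite ih natrD.
by rewrite addn0.
Qed.

Lemma ucb_wins_le k w : (ucb_wins k w <= k)%N.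
Proof.
elim: k => [|k ih]; first by rewrite /ucb_wins big_geq.
by rewrite ucb_winsS -addn1 leq_add// leq_b1.
Qed.

(** The opening bid 1 always wins, so [N] is a genuine divisor from round 2 on. *)
Lemma ucb_wins_gt0 k w : (0 < k)%N -> (0 < ucb_wins k w)%N.
Proof.
case: k => // k _; rewrite /ucb_wins big_ltn// addn_gt0 lt0b; apply/orP; left.
by rewrite /ucb_win /ucb_B /ucb_bid /=; case/andP: (M01 1 w).
Qed.

(** The count before a won round grows by one at that round, so over the won rounds after the first
    it takes the values 1, 2, 3, ... once each. *)
Lemma sum_ucb_wins (g : nat -> R) (k : nat) w : (0 < k)%N ->
  \sum_(1 <= j < k) g (ucb_wins j w) * (ucb_win j.+1 w)%:R =
  \sum_(1 <= n < ucb_wins k w) g n.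
Proof.
case: k => // k _; elim: k => [|k ih].
  have := ucb_wins_le 1 w; rewrite big_geq// => h; rewrite big_geq//.
rewrite big_nat_recr//= {}ih [in RHS]ucb_winsS; case: ucb_win; last by rewrite mulr0 addr0 addn0.
by rewrite mulr1 addn1 big_nat_recr//= ucb_wins_gt0.
Qed.

End ucb_pathwise.

(** * Measurability of the statistics and bids *)

Section ucb_measurable.
Context {R : realType} (F : R -> R) (gamma : R).
Hypothesis Fnd : {homo F : x y / x <= y}.
Hypothesis cF : {within `[0, 1], continuous F}.
Context d (T : measurableType d) (V M : nat -> T -> R).

Local Notation stats := (ucb_stats F gamma V M).
Local Notation B := (ucb_B F gamma V M).

Let measurable_inv (h : T -> R) : (forall w, 0 <= h w) ->
  measurable_fun setT h -> measurable_fun setT (fun w => (h w)^-1).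
Proof.
move=> h0 mh; rewrite (_ : (fun _ => _) = (@powR R ^~ (-1)) \o h).
  by apply: measurableT_comp mh; exact: measurable_powR.
by apply/funext => w /=; rewrite powR_inv1.
Qed.

Let stats1_ge0 k w : 0 <= (stats k w).1.
Proof. by rewrite ucb_stats1. Qed.

Let measurable_sqrt : measurable_fun setT (@Num.sqrt R).
Proof. by apply: nondecreasing_measurable => // x y; exact: ler_wsqrtr. Qed.

(** The bid is a monotone, hence Borel, function of the optimistic value [h]. *)
Lemma measurable_ucb_B_stats k :
  measurable_fun setT (fun w => (stats k w).1) ->
  measurable_fun setT (fun w => (stats k w).2) ->
  measurable_fun setT (B k.+1).
Proof.
move=> m1 m2; rewrite /ucb_B /ucb_bid /=.
case: (_ <= 1)%N; first exact: measurable_cst.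
pose bid u := maxargmax01 (fun b => (u - b) * F b).
have mbid : measurable_fun setT bid.
  by apply: nondecreasing_measurable => // x y; exact: maxargmax01_homo.
pose h w := (stats k w).2 / (stats k w).1 +
  Num.sqrt (gamma * ln k%:R / 2 * (stats k w).1^-1).
rewrite (_ : (fun _ => _) = bid \o h).
  apply: measurableT_comp => //; apply: measurable_funD.
    by apply: measurable_funM => //; exact: measurable_inv.
  apply: measurableT_comp => //; apply: measurable_funM => //.
  exact: measurable_inv.
by apply/funext => w; rewrite /bid /h /= invfM mulrA.
Qed.

(** The measurable space is arbitrary and only the first [k] rounds are constrained: taken on the
    sigma-algebra of the past, this is adaptedness. *)
Lemma measurable_ucb_stats k :
  (forall i, (1 <= i <= k)%N -> measurable_fun setT (V i)) ->
  (forall i, (1 <= i <= k)%N -> measurable_fun setT (M i)) ->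
  measurable_fun setT (fun w => (stats k w).1) /\
  measurable_fun setT (fun w => (stats k w).2).
Proof.
elim: k => [|k ih] mV mM; first by split; exact: measurable_cst.
have [i|i|m1 m2] := ih.
- by move=> /andP[i0 ik]; apply: mV; rewrite i0 leqW.
- by move=> /andP[i0 ik]; apply: mM; rewrite i0 leqW.
have mV' := mV k.+1 ltac:(by rewrite leqnn).
have mM' := mM k.+1 ltac:(by rewrite leqnn).
have mwin : measurable_fun setT (ucb_win F gamma V M k.+1).
  by apply: measurable_fun_ler => //; exact: measurable_ucb_B_stats.
split.
  rewrite (_ : (fun _ => _) = fun w =>
      if ucb_win F gamma V M k.+1 w then (stats k w).1 + 1 else (stats k w).1).
    by apply: measurable_fun_ifT => //; exact: measurable_funD.
  by apply/funext => w; rewrite ucb_statsS; case: ifP.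
rewrite (_ : (fun _ => _) = fun w =>
    if ucb_win F gamma V M k.+1 w then (stats k w).2 + V k.+1 w else (stats k w).2).
  by apply: measurable_fun_ifT => //; exact: measurable_funD.
by apply/funext => w; rewrite ucb_statsS; case: ifP.
Qed.

Lemma measurable_ucb_B k :
  (forall i, (1 <= i <= k)%N -> measurable_fun setT (V i)) ->
  (forall i, (1 <= i <= k)%N -> measurable_fun setT (M i)) ->
  measurable_fun setT (B k.+1).
Proof.
by move=> mV mM; have [] := measurable_ucb_stats mV mM; exact: measurable_ucb_B_stats.
Qed.

Lemma measurable_ucb_win k :
  (forall i, (1 <= i <= k)%N -> measurable_fun setT (V i)) ->
  (forall i, (1 <= i <= k.+1)%N -> measurable_fun setT (M i)) ->
  measurable_fun setT (ucb_win F gamma V M k.+1).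
Proof.
move=> mV mM; apply: measurable_fun_ler.
  by apply: mM; rewrite leqnn.
by apply: measurable_ucb_B => // i /andP[i0 ik]; apply: mM; rewrite i0 leqW.
Qed.

End ucb_measurable.

Lemma measurable_bool_real {R : realType} {d} {T : measurableType d} (b : T -> bool) :
  measurable_fun setT b -> measurable_fun setT (fun w => (b w)%:R : R).
Proof.
move=> mb; rewrite (_ : (fun _ => _) = fun w => if b w then 1 else 0).
  exact: measurable_fun_ifT.
by apply/funext => w; case: (b w).
Qed.

(** * Integrals of nonnegative real functions *)

Section ge0_integral_real.
Context {R : realType} {d} {T : measurableType d} (mu : {measure set T -> \bar R}).
Implicit Types f g : T -> R.

Lemma ge0_integralD_real f g : (forall w, 0 <= f w) -> (forall w, 0 <= g w) ->
  measurable_fun setT f -> measurable_fun setT g ->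
  (\int[mu]_w (f w + g w)%:E = \int[mu]_w (f w)%:E + \int[mu]_w (g w)%:E)%E.
Proof.
move=> f0 g0 /measurable_EFinP mf /measurable_EFinP mg.
rewrite -ge0_integralD//.
- by move=> w _; rewrite lee_fin.
- by move=> w _; rewrite lee_fin.
Qed.

Lemma ge0_integralZl_real f k : 0 <= k -> (forall w, 0 <= f w) -> measurable_fun setT f ->
  (\int[mu]_w (k * f w)%:E = k%:E * \int[mu]_w (f w)%:E)%E.
Proof.
move=> k0 f0 /measurable_EFinP mf.
rewrite -ge0_integralZl_EFin//.
by move=> w _; rewrite lee_fin.
Qed.

Lemma ge0_le_integral_real f g : (forall w, 0 <= f w) ->
  measurable_fun setT f -> measurable_fun setT g -> (forall w, f w <= g w) ->
  (\int[mu]_w (f w)%:E <= \int[mu]_w (g w)%:E)%E.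
Proof.
move=> f0 /measurable_EFinP mf /measurable_EFinP mg fg.
by apply: ge0_le_integral => // w _; rewrite lee_fin.
Qed.

Lemma ge0_integral_sum_real (I : Type) (s : seq I) (f : I -> T -> R) :
  (forall i w, 0 <= f i w) -> (forall i, measurable_fun setT (f i)) ->
  (\int[mu]_w (\sum_(i <- s) f i w)%:E = \sum_(i <- s) \int[mu]_w (f i w)%:E)%E.
Proof.
move=> f0 mf; rewrite -ge0_integral_sum//.
- by apply: eq_integral => w _; rewrite sumEFin.
- by move=> i; exact/measurable_EFinP.
- by move=> i w _; rewrite lee_fin.
Qed.

End ge0_integral_real.

Lemma integral_cst_probability {R : realType} {d} {T : measurableType d}
  (P : probability T R) (r : R) : (\int[P]_w r%:E = r%:E)%E.
Proof. by have := integral_cst P measurableT r%:E; rewrite /= probability_setT mule1. Qed.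

(** * The probabilistic model and its exponential supermartingale *)

Section ucb_probability.
Context {R : realType} {d} {T : measurableType d} (P : probability T R).
Context (V M : nat -> T -> R) (v : R) (F : R -> R) (gamma : R).
Hypothesis mV : forall t, measurable_fun setT (V t).
Hypothesis mM : forall t, measurable_fun setT (M t).
Hypothesis V01 : forall t w, 0 <= V t w <= 1.
Hypothesis M01 : forall t w, 0 <= M t w <= 1.
Hypothesis idV : forall t A, measurable A -> P (V t @^-1` A) = P (V 1 @^-1` A).
Hypothesis cdfM : forall t b, P [set w | M t w <= b] = (F b)%:E.
Hypothesis indepVM : mutually_independent P (fun i : nat + nat =>
    match i with inl t => V t | inr t => M t end).
Hypothesis meanV : (\int[P]_w (V 1 w)%:E = v%:E)%E.
Hypothesis cF : {within `[0, 1], continuous F}.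

Lemma mean_in01 : 0 <= v <= 1.
Proof.
rewrite -!lee_fin -meanV; apply/andP; split.
  by apply: integral_ge0 => w _; rewrite lee_fin; case/andP: (V01 1 w).
rewrite -[leRHS](integral_cst_probability P).
apply: ge0_le_integral => //.
- by move=> w _; rewrite lee_fin; case/andP: (V01 1 w).
- exact/measurable_EFinP.
- by move=> w _; rewrite lee_fin; case/andP: (V01 1 w).
Qed.

Lemma cdf_homo : {homo F : x y / x <= y}.
Proof.
move=> x y xy; rewrite -lee_fin -!(cdfM 0).
have mset b : measurable [set w | M 0 w <= b].
  rewrite -[X in measurable X]setTI; exact: (measurable_fun_ler (mM 0) (measurable_cst b)).
by apply: le_measure; rewrite ?inE// => w /= /le_trans; exact.
Qed.

Lemma cdf_in01 x : 0 <= F x <= 1.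
Proof.
rewrite -!lee_fin -(cdfM 0) measure_ge0 probability_le1//.
rewrite -[X in measurable X]setTI; exact: (measurable_fun_ler (mM 0) (measurable_cst x)).
Qed.

Lemma cdf1 : F 1 = 1.
Proof.
apply: EFin_inj; rewrite -(cdfM 0) -(probability_setT P); congr (P _).
by apply/seteqP; split => // w _ /=; case/andP: (M01 0 w).
Qed.

Lemma cdf_lt0 x : x < 0 -> F x = 0.
Proof.
move=> x0; apply: EFin_inj; rewrite -(cdfM 0).
transitivity (P set0); last by rewrite measure0.
congr (P _).
apply/seteqP; split => // w /= Mx; have /andP[] := M01 0 w.
by rewrite leNgt (le_lt_trans Mx x0).
Qed.

Let X (i : nat + nat) := match i with inl t => V t | inr t => M t end.

Let mX i : measurable_fun setT (X i). Proof. by case: i. Qed.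

Definition past (k : nat) : seq (nat + nat) :=
  [seq inl i | i <- iota 1 k] ++ [seq inr i | i <- iota 1 k].

Local Notation past_measurable k := (g_sigma_algebraType (cylinders X (past k))).
(** The past enlarged by [M k.+1] decides whether round [k.+1] is won, yet remains independent of
    [V k.+1]. *)
Local Notation past_M_measurable k :=
  (g_sigma_algebraType (cylinders X (inr k.+1 :: past k))).

Let mem_past_l k i : (inl i \in past k) = (1 <= i < 1 + k)%N.
Proof.
rewrite mem_cat mem_map ?mem_iota; last by move=> ? ? [].
by rewrite orbC; case: mapP => // -[].
Qed.

Let mem_past_r k i : (inr i \in past k) = (1 <= i < 1 + k)%N.
Proof.
rewrite mem_cat mem_map ?mem_iota; last by move=> ? ? [].
by case: mapP => // -[].
Qed.

Let uniq_past k : uniq (past k).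
Proof.
rewrite cat_uniq !map_inj_uniq ?iota_uniq//=; [|by move=> ? ? []..].
by rewrite andbT; apply/hasPn => _ /mapP[i _ ->]; apply/negP => /mapP[].
Qed.

Let notin_past k : inr k.+1 \notin past k.
Proof. by rewrite mem_past_r add1n ltnn. Qed.

Let notin_past_M k : inl k.+1 \notin inr k.+1 :: past k.
Proof. by rewrite inE negb_or /= mem_past_l add1n ltnn. Qed.

Let past_V k i : (1 <= i <= k)%N -> measurable_fun (T := past_measurable k) setT (V i).
Proof.
move=> ik; apply: (@measurable_cylinders _ _ _ _ X _ (inl i)).
by rewrite mem_past_l add1n ltnS.
Qed.

Let past_M k i : (1 <= i <= k)%N -> measurable_fun (T := past_measurable k) setT (M i).
Proof.
move=> ik; apply: (@measurable_cylinders _ _ _ _ X _ (inr i)).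
by rewrite mem_past_r add1n ltnS.
Qed.

Let past_M_V k i : (1 <= i <= k)%N -> measurable_fun (T := past_M_measurable k) setT (V i).
Proof.
move=> ik; apply: (@measurable_cylinders _ _ _ _ X _ (inl i)).
by rewrite inE /= mem_past_l add1n ltnS.
Qed.

Let past_M_M k i : (1 <= i <= k.+1)%N -> measurable_fun (T := past_M_measurable k) setT (M i).
Proof.
move=> /andP[i0 ik]; apply: (@measurable_cylinders _ _ _ _ X _ (inr i)).
rewrite inE mem_past_r add1n i0 /= ltnS; move: ik; rewrite leq_eqVlt ltnS.
by case/orP => [/eqP ->|->]; rewrite ?eqxx ?orbT.
Qed.

(** The conditional probability given the past is [F c], expressed through nonnegative test
    functions [Y]. *)
Lemma expectation_next_M k (Y : T -> R) c : (forall w, 0 <= Y w) ->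
  measurable_fun (T := past_measurable k) setT Y ->
  (\int[P]_w (Y w * (M k.+1 w <= c)%R%:R)%:E = \int[P]_w (Y w)%:E * (F c)%:E)%E.
Proof.
move=> Y0 mY; pose h x : R := (x <= c)%R%:R.
have mh : measurable_fun setT h.
  by apply: measurable_bool_real; exact: measurable_fun_ler.
rewrite (@ge0_expectation_indep _ _ _ P _ X mX indepVM (past k) (inr k.+1) Y h)//.
congr (_ * _)%E; rewrite -(cdfM k.+1).
have mset : measurable [set w | M k.+1 w <= c].
  rewrite -[X in measurable X]setTI.
  exact: (measurable_fun_ler (mM k.+1) (measurable_cst c)).
transitivity (\int[P]_w (\1_[set w | M k.+1 w <= c] w)%:E)%E; last by rewrite integral_indic// setIT.
by apply: eq_integral => w _; rewrite /h /= indicE mem_setE.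
Qed.

Let meanVt k : (\int[P]_w (V k w)%:E = v%:E)%E.
Proof.
rewrite -meanV.
pose D t : probability _ R := distribution P
  (HB.pack (V t) (isMeasurableFun.Build _ _ _ _ _ (mV t)) : {mfun T >-> R}).
have DE t : (\int[P]_w (V t w)%:E = \int[D t]_x (Num.max x 0)%:E)%E.
  rewrite ge0_integral_distribution//; last 2 first.
  - by apply/measurable_EFinP; apply: measurable_maxr.
  - by move=> x; rewrite lee_fin le_max lexx orbT.
  by apply: eq_integral => w _ /=; rewrite max_l//; case/andP: (V01 t w).
rewrite !DE; apply: eq_measure_integral => A mA _; exact: idV.
Qed.

Let mean_onemV k : (\int[P]_w (1 - V k w)%:E = (1 - v)%:E)%E.
Proof.
have : (\int[P]_w (1 - V k w)%:E + \int[P]_w (V k w)%:E = 1%:E)%E.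
  rewrite -ge0_integralD_real//.
  - by under eq_integral do rewrite subrK; rewrite integral_cst_probability.
  - by move=> w; rewrite subr_ge0; case/andP: (V01 k w).
  - by move=> w; case/andP: (V01 k w).
  - exact: measurable_funB.
rewrite meanVt; case: (\int[P]_w _)%E => // r [] <-.
by rewrite addrK.
Qed.

(** The chord bound replaces [V k] by a Bernoulli variable of the same mean, to which [hoeffding]
    applies. *)
Lemma chernoff_factor k l :
  (\int[P]_w (expR (l * (V k w - v) - l ^+ 2 / 8))%:E <= 1)%E.
Proof.
pose c := expR (- (l * v + l ^+ 2 / 8)).
have c0 : 0 <= c by exact: expR_ge0.
have e0 : 0 <= expR l by exact: expR_ge0.
have V0 w : 0 <= V k w by case/andP: (V01 k w).
have V1 w : 0 <= 1 - V k w by rewrite subr_ge0; case/andP: (V01 k w).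
have mV1 : measurable_fun setT (fun w => 1 - V k w) by exact: measurable_funB.
have mV2 : measurable_fun setT (fun w => expR l * V k w) by exact: measurable_funM.
have mV3 : measurable_fun setT (fun w => (1 - V k w) + expR l * V k w).
  exact: measurable_funD.
apply: (@le_trans _ _ (\int[P]_w (c * ((1 - V k w) + expR l * V k w))%:E)%E).
  apply: ge0_le_integral_real => //.
  - apply: measurableT_comp => //; apply: measurable_funB => //.
    by apply: measurable_funM => //; exact: measurable_funB.
  - exact: measurable_funM.
  move=> w; have -> : l * (V k w - v) - l ^+ 2 / 8 =
    - (l * v + l ^+ 2 / 8) + l * V k w by ring.
  by rewrite expRD ler_wpM2l// [expR l * _]mulrC expR_chord.
rewrite ge0_integralZl_real//; last by move=> w; rewrite addr_ge0// mulr_ge0.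
rewrite ge0_integralD_real//; last by move=> w; rewrite mulr_ge0.
rewrite mean_onemV ge0_integralZl_real// meanVt -EFinM lee_fin /c expRN.
rewrite mulrC ler_pdivrMr ?expR_gt0// mul1r [expR l * v]mulrC.
exact/hoeffding/mean_in01.
Qed.

Local Notation stats := (ucb_stats F gamma V M).

Definition ucb_exp_martingale (l : R) (k : nat) (w : T) : R :=
  expR (l * ((stats k w).2 - v * (stats k w).1) - (stats k w).1 * l ^+ 2 / 8).

Lemma measurable_ucb_exp_martingale d' (T' : measurableType d') (V' M' : nat -> T' -> R) l k :
  measurable_fun setT (fun w => (ucb_stats F gamma V' M' k w).1) ->
  measurable_fun setT (fun w => (ucb_stats F gamma V' M' k w).2) ->
  measurable_fun setT (fun w => expR (l * ((ucb_stats F gamma V' M' k w).2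
    - v * (ucb_stats F gamma V' M' k w).1) - (ucb_stats F gamma V' M' k w).1 * l ^+ 2 / 8)).
Proof.
move=> m1 m2; apply: measurableT_comp => //; apply: measurable_funB.
  apply: measurable_funM => //; apply: measurable_funB => //.
  exact: measurable_funM.
by apply: measurable_funM => //; exact: measurable_funM.
Qed.

(** A lost round leaves the process unchanged. A won round multiplies it by [h (V k.+1)], which is
    independent of [Y1] and has mean at most 1. *)
Lemma expectation_ucb_exp_martingale l k :
  (\int[P]_w (ucb_exp_martingale l k w)%:E <= 1)%E.
Proof.
have Fnd := cdf_homo.
elim: k => [|k ih].
  rewrite (eq_integral (cst 1%E)); first by rewrite integral_cst_probability.
  by move=> w _; rewrite /ucb_exp_martingale /= mulr0 subr0 mulr0 !mul0r subr0 expR0.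
pose W := ucb_exp_martingale l k.
pose win := ucb_win F gamma V M k.+1.
pose Y1 w := W w * (win w)%:R.
pose Y0 w := W w * (~~ win w)%:R.
pose h x := expR (l * (x - v) - l ^+ 2 / 8).
have mW : measurable_fun setT W.
  have [m1 m2] := measurable_ucb_stats gamma Fnd cF (fun i (_ : (1 <= i <= k)%N) => mV i)
    (fun i _ => mM i).
  exact: measurable_ucb_exp_martingale.
have mwin : measurable_fun setT win.
  exact: (measurable_ucb_win gamma Fnd cF (fun i _ => mV i) (fun i _ => mM i)).
have mY1 : measurable_fun (T := past_M_measurable k) setT Y1.
  apply: measurable_funM.
    have mMk i : (1 <= i <= k)%N -> measurable_fun (T := past_M_measurable k) setT (M i).
      by move=> /andP[i0 ik]; apply: past_M_M; rewrite i0 leqW.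
    have [m1 m2] := measurable_ucb_stats gamma Fnd cF (T := past_M_measurable k)
      (@past_M_V k) mMk.
    exact: (@measurable_ucb_exp_martingale _ (past_M_measurable k) V M).
  apply: (measurable_bool_real (T := past_M_measurable k)).
  exact: (measurable_ucb_win gamma Fnd cF (T := past_M_measurable k) (@past_M_V k) (@past_M_M k)).
have W0 w : 0 <= W w by exact: expR_ge0.
have Y10 w : 0 <= Y1 w by exact: mulr_ge0.
have Y00 w : 0 <= Y0 w by exact: mulr_ge0.
have mY0 : measurable_fun setT Y0.
  apply: measurable_funM => //; apply: measurable_bool_real; exact: measurable_neg.
have mY1' : measurable_fun setT Y1.
  by apply: measurable_funM => //; apply: measurable_bool_real.
have mh : measurable_fun setT h.
  by apply: measurableT_comp => //; apply: measurable_funB => //; apply: measurable_funM => //; apply: measurable_funB.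
have h0 x : 0 <= h x by exact: expR_ge0.
have step w : ucb_exp_martingale l k.+1 w = Y0 w + Y1 w * h (V k.+1 w).
  rewrite /Y0 /Y1 /W /h /ucb_exp_martingale ucb_statsS -/(win w).
  case: (win w) => /=; last by rewrite mulr1 mulr0 mul0r addr0.
  rewrite mulr0 add0r mulr1 -expRD; congr expR; ring.
under eq_integral do rewrite step.
rewrite ge0_integralD_real//; last 2 first.
- by move=> w; rewrite mulr_ge0.
- by apply: measurable_funM => //; exact: measurableT_comp.
rewrite (@ge0_expectation_indep _ _ _ P _ X mX indepVM (inr k.+1 :: past k) (inl k.+1) Y1 h)//; last first.
  by rewrite /= notin_past uniq_past.
apply: le_trans ih.
have -> : (\int[P]_w (ucb_exp_martingale l k w)%:E = \int[P]_w (Y0 w)%:E + \int[P]_w (Y1 w)%:E)%E.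
  rewrite -ge0_integralD_real//.
  apply: eq_integral => w _; rewrite /Y0 /Y1 /W; congr EFin.
  by case: (win w) => /=; rewrite mulr0 mulr1 ?add0r ?addr0.
apply: leeD2l; rewrite -[leRHS]mule1; apply: lee_wpmul2l.
  by apply: integral_ge0 => w _; rewrite lee_fin.
exact: chernoff_factor.
Qed.

Hypothesis Fbstar_gt0 : 0 < F (bstar v F).

Local Notation B := (ucb_B F gamma V M).
Local Notation win := (ucb_win F gamma V M).
Local Notation wins := (ucb_wins F gamma V M).
Local Notation b0 := (bstar v F).

Let mU x : measurable_fun setT (U x F).
Proof.
apply: measurable_funM; first exact: measurable_funB.
exact: nondecreasing_measurable cdf_homo.
Qed.

Let mstats k : measurable_fun setT (fun w => (stats k w).1) /\
  measurable_fun setT (fun w => (stats k w).2).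
Proof.
exact: (measurable_ucb_stats gamma cdf_homo cF (fun i _ => mV i) (fun i _ => mM i)).
Qed.

Let mB k : measurable_fun setT (B k.+1).
Proof.
exact: (measurable_ucb_B gamma cdf_homo cF (fun i _ => mV i) (fun i _ => mM i)).
Qed.

Let mwin k : measurable_fun setT (win k.+1).
Proof.
exact: (measurable_ucb_win gamma cdf_homo cF (fun i _ => mV i) (fun i _ => mM i)).
Qed.

Let mW l k : measurable_fun setT (ucb_exp_martingale l k).
Proof. by have [m1 m2] := mstats k; exact: measurable_ucb_exp_martingale. Qed.

(** * Probability of a bad round *)

Section deviation.
Context (delta gamma' : R).
Hypothesis peeling : forall L N D, 0 <= L -> 1 <= N -> ln N <= L ->
  Num.sqrt (gamma * L / (2 * N)) * N <= D ->
  exists2 j, (j < peel_slices delta L)%N &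
    gamma' * L <= peel_exponent gamma delta L j * D -
      N * peel_exponent gamma delta L j ^+ 2 / 8.

Definition ucb_width (k : nat) (w : T) : R :=
  Num.sqrt (gamma * ln k%:R / (2 * (stats k w).1)).

Definition ucb_mean (k : nat) (w : T) : R := (stats k w).2 / (stats k w).1.

(** A majorant of the indicator of a bad round: for each slice and each sign of the deviation, the
    supermartingale divided by the threshold [expR (gamma' * ln k)]. Integrating it performs
    Markov's inequality and the union bound at once. *)
Definition deviation_bound (k : nat) (w : T) : R :=
  \sum_(j < peel_slices delta (ln k%:R)) expR (- (gamma' * ln k%:R)) *
    (ucb_exp_martingale (peel_exponent gamma delta (ln k%:R) j) k w +
     ucb_exp_martingale (- peel_exponent gamma delta (ln k%:R) j) k w).

Let dev_term_ge0 l k w : 0 <= expR (- (gamma' * ln k%:R)) *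
    (ucb_exp_martingale l k w + ucb_exp_martingale (- l) k w).
Proof. by rewrite mulr_ge0 ?expR_ge0// addr_ge0// expR_ge0. Qed.

Lemma deviation_bound_ge0 k w : 0 <= deviation_bound k w.
Proof. by apply: sumr_ge0 => j _; exact: dev_term_ge0. Qed.

Let stats1_bounds k w : (0 < k)%N -> 1 <= (stats k w).1 /\ (stats k w).1 <= k%:R.
Proof.
by move=> k0; rewrite ucb_stats1 ler1n ler_nat ucb_wins_le ucb_wins_gt0.
Qed.

(** On a bad round the term for the slice of [N] and the sign of the deviation reaches its
    threshold; the others are nonnegative. *)
Lemma deviation_bound_ge1 k w : (0 < k)%N ->
  ucb_width k w < `|v - ucb_mean k w| -> 1 <= deviation_bound k w.
Proof.
move=> k0 dev; have [N1 Nk] := stats1_bounds w k0.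
have L0 : 0 <= ln k%:R :> R by rewrite ln_ge0// ler1n.
have NL : ln (stats k w).1 <= ln k%:R by rewrite ler_ln ?posrE//; lra.
have N0 : 0 < (stats k w).1 by lra.
have [j jK hj] := peeling L0 N1 NL (ler_wpM2r (ltW N0) (ltW dev)).
set l := peel_exponent gamma delta (ln k%:R) j in hj.
have lead : 1 <= expR (- (gamma' * ln k%:R)) *
    (ucb_exp_martingale l k w + ucb_exp_martingale (- l) k w).
  suff : expR (gamma' * ln k%:R) <= ucb_exp_martingale l k w + ucb_exp_martingale (- l) k w.
    move=> /(ler_wpM2l (expR_ge0 (- (gamma' * ln k%:R)))).
    by rewrite -expRD addNr expR0.
  have SE : (stats k w).2 = ucb_mean k w * (stats k w).1 by rewrite /ucb_mean divfK// gt_eqF.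
  case: (ger0P (v - ucb_mean k w)) dev hj => h _ hj.
    apply: (@le_trans _ _ (ucb_exp_martingale (- l) k w)); last by rewrite lerDr expR_ge0.
    by rewrite ler_expR (le_trans hj)// SE sqrrN; lra.
  apply: (@le_trans _ _ (ucb_exp_martingale l k w)); last by rewrite lerDl expR_ge0.
  by rewrite ler_expR (le_trans hj)// SE; lra.
rewrite /deviation_bound (bigD1 (Ordinal jK))//=.
by rewrite (le_trans lead)// lerDl; apply: sumr_ge0 => i _; exact: dev_term_ge0.
Qed.

Let mdev l k : measurable_fun setT (fun w => expR (- (gamma' * ln k%:R)) *
    (ucb_exp_martingale l k w + ucb_exp_martingale (- l) k w)).
Proof. by apply: measurable_funM => //; exact: measurable_funD. Qed.

Lemma measurable_deviation_bound k : measurable_fun setT (deviation_bound k).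
Proof. exact: measurable_sum. Qed.

Lemma expectation_deviation_bound k : (\int[P]_w (deviation_bound k w)%:E <=
  (2 * ((peel_slices delta (ln (k%:R : R)))%:R * expR (- (gamma' * ln k%:R))))%:E)%E.
Proof.
rewrite ge0_integral_sum_real//.
rewrite (_ : 2 * _ = \sum_(j < peel_slices delta (ln (k%:R : R)))
  (expR (- (gamma' * ln k%:R)) * (1 + 1))); last first.
  by rewrite sumr_const card_ord -mulr_natl; ring.
rewrite -sumEFin; apply: lee_sum => j _.
rewrite ge0_integralZl_real ?expR_ge0//; last 2 first.
- by move=> w; rewrite addr_ge0// expR_ge0.
- exact: measurable_funD.
rewrite EFinM; apply: lee_wpmul2l; first by rewrite lee_fin expR_ge0.
rewrite ge0_integralD_real//; [|by move=> w; exact: expR_ge0..].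
by rewrite EFinD; apply: leeD; exact: expectation_ucb_exp_martingale.
Qed.

End deviation.

(** * Cost of the good rounds *)

Section exploration.
Context (A kappa : R).
Hypothesis A0 : 0 <= A.
Hypothesis kappa0 : 0 <= kappa.

(* Bounds the gap of a round on which the confidence interval around [v] holds; the power is an
   inverse, written so as to be visibly measurable. *)
Definition round_cost (x : R) : R := A * x `^ (-1) + 2 * (x <= kappa)%R%:R.

Let round_cost_ge0 x : 0 <= round_cost x.
Proof. by rewrite addr_ge0// mulr_ge0// powR_ge0. Qed.

Let mcost : measurable_fun setT round_cost.
Proof.
apply: measurable_funD.
  by apply: measurable_funM => //; exact: measurable_powR.
apply: measurable_funM => //; apply: measurable_bool_real.
exact: measurable_fun_ler.
Qed.

(** A bid of at least [b0] wins as soon as [M k.+1 <= b0]. That event has probability [F b0] and is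
    independent of the past, which determines the cost and the bid. *)
Lemma expectation_round_cost k :
  (\int[P]_w (round_cost (stats k w).1 * (b0 <= B k.+1 w)%R%:R)%:E <=
   (F b0)^-1%:E * \int[P]_w (round_cost (stats k w).1 * (win k.+1 w)%:R)%:E)%E.
Proof.
pose Y w := round_cost (stats k w).1 * (b0 <= B k.+1 w)%R%:R.
have Y0 w : 0 <= Y w by exact: mulr_ge0.
have mY : measurable_fun (T := past_measurable k) setT Y.
  have [m1 _] := measurable_ucb_stats gamma cdf_homo cF (T := past_measurable k)
    (@past_V k) (@past_M k).
  have m2 := measurable_ucb_B gamma cdf_homo cF (T := past_measurable k)
    (@past_V k) (@past_M k).
  apply: measurable_funM; first exact: measurableT_comp.
  by apply: (measurable_bool_real (T := past_measurable k)); exact: measurable_fun_ler.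
have [m1 _] := mstats k.
have mc : measurable_fun setT (fun w => round_cost (stats k w).1) by exact: measurableT_comp.
have mY' : measurable_fun setT Y.
  apply: measurable_funM => //; apply: measurable_bool_real.
  by apply: measurable_fun_ler => //; exact: mB.
have : (\int[P]_w (Y w)%:E * (F b0)%:E <=
    \int[P]_w (round_cost (stats k w).1 * (win k.+1 w)%:R)%:E)%E.
  rewrite -(expectation_next_M b0 Y0 mY); apply: ge0_le_integral_real.
  - by move=> w; exact: mulr_ge0.
  - apply: measurable_funM => //; apply: measurable_bool_real.
    by apply: measurable_fun_ler.
  - by apply: measurable_funM => //; apply: measurable_bool_real; exact: mwin.
  move=> w; rewrite /Y -mulrA; apply: ler_wpM2l => //.
  rewrite /ucb_win; case: (leP b0) => //= bB; last by rewrite mul0r.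
  rewrite mul1r; case: (leP _ b0) => // Mb.
  by rewrite (le_trans Mb bB).
move=> /(lee_wpmul2l (_ : 0 <= (F b0)^-1%:E)%E) -/(_ _) h.
apply: le_trans (h _); last by rewrite lee_fin invr_ge0 ltW.
by rewrite muleCA -EFinM mulVf ?gt_eqF// mule1.
Qed.

Lemma sum_round_cost n : (0 < n)%N ->
  \sum_(1 <= j < n.+1) round_cost j%:R <= A * (1 + ln n%:R) + 2 * kappa.
Proof.
move=> n0; rewrite big_split/= -!mulr_sumr; apply: lerD; apply: ler_wpM2l => //.
  by under eq_bigr do rewrite powR_inv1//; exact: harmonic_le.
exact: sum_indicator_le.
Qed.

Lemma expectation_exploration n : (0 < n)%N ->
  (\sum_(1 <= k < n) \int[P]_w (round_cost (stats k w).1 * (win k.+1 w)%:R)%:E <=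
   (A * (1 + ln n%:R) + 2 * kappa)%:E)%E.
Proof.
move=> n0.
have mc k : measurable_fun setT (fun w => round_cost (stats k w).1 * (win k.+1 w)%:R).
  have [m1 _] := mstats k; apply: measurable_funM; first exact: measurableT_comp.
  by apply: measurable_bool_real; exact: mwin.
rewrite -ge0_integral_sum_real//; last by move=> k w; exact: mulr_ge0.
rewrite -[leRHS](integral_cst_probability P); apply: ge0_le_integral_real => //.
- by move=> w; apply: sumr_ge0 => k _; exact: mulr_ge0.
- exact: measurable_sum.
move=> w; under eq_bigr do rewrite ucb_stats1.
rewrite (@sum_ucb_wins _ _ _ _ _ _ M01 (fun j => round_cost j%:R))//.
apply: le_trans (sum_round_cost n0).
(* Completing the sum up to [n] with nonnegative terms makes the bound independent of the
   trajectory. *)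
have wn : (wins n w <= n.+1)%N by rewrite leqW// ucb_wins_le.
rewrite (big_cat_nat _ wn)//=; last exact: ucb_wins_gt0.
by rewrite lerDl; apply: sumr_ge0.
Qed.

End exploration.

(** * Regret as a sum of expected gaps *)

Section regret_decomposition.
Context (f : R -> R) (Delta c_f C_f lambda : R).
Hypothesis dF : forall b, b \in `]0, 1[ -> derivable F b 1 /\ derive1 F b = f b.
Hypothesis slc : {in `]0, 1[ &, forall x y, x < y -> f y / F y < f x / F x}.
Hypothesis Delta_gt0 : 0 < Delta.
Hypothesis c_f_gt0 : 0 < c_f.
Hypothesis f_bounds :
  forall b, b \in `[b0 - Delta, b0 + Delta] -> c_f < f b < C_f.
Hypothesis phi' : forall b, b \in `[b0, b0 + Delta] ->
     derivable (fun x => x + F x / f x) b 1 /\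
     derive1 (fun x => x + F x / f x) b <= lambda.
Hypothesis gamma_gt0 : 0 < gamma.

Definition ucb_gap (t : nat) (w : T) : R := U v F b0 - U v F (B t w).

Let b0_argmax : argmax01 (U v F) b0.
Proof. exact/argmax01_maxargmax01/continuous_utility. Qed.

Let B_in01 k w : 0 <= B k.+1 w <= 1.
Proof.
rewrite /ucb_B /ucb_bid /=; case: ifP => _; first by rewrite ler01 lexx.
set g := fun b => _; have [+ _] : argmax01 g (maxargmax01 g).
  exact/argmax01_maxargmax01/continuous_utility.
by rewrite in_itv.
Qed.

Lemma ucb_gap_ge0 k w : 0 <= ucb_gap k.+1 w.
Proof.
by rewrite subr_ge0; case: b0_argmax => _; apply; rewrite in_itv/= B_in01.
Qed.

Lemma ucb_gap_le2 k w : ucb_gap k.+1 w <= 2.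
Proof.
have [+ _] := b0_argmax; rewrite in_itv/= /ucb_gap /U => b01.
have := B_in01 k w; have := mean_in01; have := cdf_in01 b0; have := cdf_in01 (B k.+1 w).
move: b0 b01 (B k.+1 w) (F (B k.+1 w)) (F b0) => b b01 z y x y01 x01 v01 z01.
(* Both utilities lie in [[-1, 1]]. *)
have h1 : 0 <= (1 - (v - b)) * x by apply: mulr_ge0; lra.
have h2 : 0 <= (1 + (v - z)) * y by apply: mulr_ge0; lra.
lra.
Qed.

Lemma measurable_ucb_gap k : measurable_fun setT (ucb_gap k.+1).
Proof. by apply: measurable_funB => //; exact: measurableT_comp. Qed.

Lemma lambda_C_f_ge0 : 0 <= C_f * lambda.
Proof.
have h1 := C_f_gt0 Delta_gt0 c_f_gt0 f_bounds.
have h2 := lambda_ge0 cdf_homo cdf_in01 cF cdf1 cdf_lt0 dF slc mean_in01 Delta_gt0 c_f_gt0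
  f_bounds phi' Fbstar_gt0.
exact: mulr_ge0 (ltW h1) h2.
Qed.

(** On a bad round the deviation term alone exceeds the trivial gap 2. Otherwise the bid is within
    two widths above [b0]: past [b0 + Delta], [N] is at most [kappa] and the indicator pays 2;
    closer, [utility_gap] gives [A / N]. *)
Lemma ucb_gap_le delta gamma' k n w :
  (forall L N D, 0 <= L -> 1 <= N -> ln N <= L ->
    Num.sqrt (gamma * L / (2 * N)) * N <= D ->
    exists2 j, (j < peel_slices delta L)%N &
      gamma' * L <= peel_exponent gamma delta L j * D -
        N * peel_exponent gamma delta L j ^+ 2 / 8) ->
  (0 < k <= n)%N ->
  ucb_gap k.+1 w <= 2 * deviation_bound delta gamma' k w +
    round_cost (C_f * lambda * gamma * ln n%:R) (2 * gamma / Delta ^+ 2 * ln n%:R)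
      (stats k w).1 * (b0 <= B k.+1 w)%R%:R.
Proof.
move=> peeling /andP[k0 kn].
(* Both constants come from [(B - b0) ^ 2 <= 2 gamma ln n / N]: multiplied by [C_f lambda / 2] it
   gives [A / N], and compared with [Delta ^ 2] it gives [kappa]. Using [ln n] for [ln k] makes them
   common to all rounds. *)
set A := C_f * lambda * gamma * ln n%:R.
set kappa := 2 * gamma / Delta ^+ 2 * ln n%:R.
have clam := lambda_C_f_ge0.
have Lk : 0 <= ln k%:R :> R by rewrite ln_ge0// ler1n.
have Lkn : ln k%:R <= ln n%:R :> R.
  by rewrite ler_ln ?posrE ?ltr0n ?ler_nat//; apply: leq_trans kn.
have Ln := le_trans Lk Lkn.
have A0 : 0 <= A by apply: mulr_ge0 => //; apply: mulr_ge0 => //; exact: ltW.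
have kappa0 : 0 <= kappa.
  by apply: mulr_ge0 => //; rewrite divr_ge0 ?sqr_ge0// mulr_ge0// ltW.
have cost0 : 0 <= round_cost A kappa (stats k w).1 * (b0 <= B k.+1 w)%R%:R.
  by rewrite mulr_ge0// addr_ge0// mulr_ge0// powR_ge0.
have dev0 := deviation_bound_ge0 delta gamma' k w.
have gap2 := ucb_gap_le2 k w.
have [bad|] := ltP (ucb_width k w) `|v - ucb_mean k w|.
  by have := deviation_bound_ge1 peeling k0 bad; lra.
rewrite ler_norml => /andP[lo hi].
have N0 : 0 < (stats k w).1 by rewrite ucb_stats1 ltr0n ucb_wins_gt0.
pose u := ucb_mean k w + ucb_width k w.
have BE : B k.+1 w = maxargmax01 (fun b => (u - b) * F b).
  by rewrite /u /ucb_mean /ucb_width /ucb_B /ucb_bid; case: (k) k0.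
have vu : v <= u by rewrite /u; lra.
have uv : u - v <= 2 * ucb_width k w by rewrite /u; lra.
have b0B : b0 <= B k.+1 w.
  by rewrite BE; exact: (bid_ge_bstar cdf_homo cF).
have Bb0 : B k.+1 w <= b0 + (u - v).
  rewrite BE; exact: (bid_le_bstar cdf_homo cdf_in01 cF cdf1 cdf_lt0 dF slc mean_in01 Delta_gt0
    c_f_gt0 f_bounds phi' Fbstar_gt0).
have width2 : ucb_width k w ^+ 2 = gamma * ln k%:R / (2 * (stats k w).1).
  by rewrite sqr_sqrtr// divr_ge0// mulr_ge0// ltW.
have Bw : (B k.+1 w - b0) ^+ 2 <= 2 * gamma * ln n%:R / (stats k w).1.
  apply: (@le_trans _ _ ((2 * ucb_width k w) ^+ 2)).
    by rewrite ler_sqr ?nnegrE ?subr_ge0 ?mulr_ge0 ?sqrtr_ge0//; lra.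
  rewrite exprMn width2.
  have -> : 2 ^+ 2 * (gamma * ln k%:R / (2 * (stats k w).1)) =
    2 * gamma * ln k%:R / (stats k w).1 by field; exact: lt0r_neq0.
  by rewrite ler_pM2r ?invr_gt0//; apply: ler_wpM2l => //; rewrite mulr_ge0// ltW.
rewrite b0B mulr1 /round_cost powR_inv1 ?(ltW N0)//.
have [near|far] := leP (B k.+1 w) (b0 + Delta); last first.
  suff -> : (stats k w).1 <= kappa.
    have : 0 <= A * (stats k w).1^-1 by rewrite mulr_ge0// invr_ge0 ltW.
    by rewrite mulr1; lra.
  have D2 : 0 < Delta ^+ 2 by rewrite exprn_gt0.
  have : Delta ^+ 2 <= 2 * gamma * ln n%:R / (stats k w).1.
    apply: le_trans Bw; rewrite ler_sqr ?nnegrE ?subr_ge0 ?(ltW Delta_gt0)//; lra.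
  by rewrite ler_pdivlMr// mulrC -ler_pdivlMr// /kappa mulrAC.
have := utility_gap cdf_homo cdf_in01 cF cdf1 cdf_lt0 dF slc mean_in01 Delta_gt0
    c_f_gt0 f_bounds phi' Fbstar_gt0 (b := B k.+1 w).
rewrite b0B near => /(_ isT); case/andP: (B_in01 k w) => _ -> /(_ isT).
rewrite -/(ucb_gap k.+1 w) => gap.
have : C_f * lambda * (B k.+1 w - b0) ^+ 2 / 2 <= A * (stats k w).1^-1.
  apply: le_trans (_ : C_f * lambda * (2 * gamma * ln n%:R / (stats k w).1) / 2 <= _).
    by rewrite ler_pM2r ?invr_gt0//; exact: ler_wpM2l.
  by rewrite le_eqVlt; apply/orP; left; apply/eqP; rewrite /A; field; exact: lt0r_neq0.
have : (0 : R) <= 2 * ((stats k w).1 <= kappa)%R%:R by rewrite mulr_ge0.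
lra.
Qed.

Lemma expectation_ucb_gap delta gamma' k n :
  (forall L N D, 0 <= L -> 1 <= N -> ln N <= L ->
    Num.sqrt (gamma * L / (2 * N)) * N <= D ->
    exists2 j, (j < peel_slices delta L)%N &
      gamma' * L <= peel_exponent gamma delta L j * D -
        N * peel_exponent gamma delta L j ^+ 2 / 8) ->
  (0 < k <= n)%N ->
  (\int[P]_w (ucb_gap k.+1 w)%:E <=
   (4 * ((peel_slices delta (ln (k%:R : R)))%:R * expR (- (gamma' * ln k%:R))))%:E +
   (F b0)^-1%:E * \int[P]_w (round_cost (C_f * lambda * gamma * ln n%:R)
      (2 * gamma / Delta ^+ 2 * ln n%:R) (stats k w).1 * (win k.+1 w)%:R)%:E)%E.
Proof.
move=> peeling kn; have [m1 _] := mstats k.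
set A := C_f * _ * _ * _; set kappa := 2 * _ / _ * _.
have n1 : (0 < n)%N by case/andP: kn => k0; exact: leq_trans.
have Ln : 0 <= ln n%:R :> R by rewrite ln_ge0// ler1n.
have A0 : 0 <= A.
  by apply: mulr_ge0 => //; rewrite mulr_ge0 ?lambda_C_f_ge0// ltW.
have kappa0 : 0 <= kappa.
  by apply: mulr_ge0 => //; rewrite divr_ge0 ?sqr_ge0// mulr_ge0// ltW.
have cost0 w : 0 <= round_cost A kappa (stats k w).1 * (b0 <= B k.+1 w)%R%:R.
  by rewrite mulr_ge0// addr_ge0// mulr_ge0// powR_ge0.
have mcost : measurable_fun setT (round_cost A kappa).
  apply: measurable_funD.
    by apply: measurable_funM => //; exact: measurable_powR.
  apply: measurable_funM => //; apply: measurable_bool_real.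
  exact: measurable_fun_ler.
have mc : measurable_fun setT
    (fun w => round_cost A kappa (stats k w).1 * (b0 <= B k.+1 w)%R%:R).
  apply: measurable_funM; first exact: measurableT_comp.
  by apply: measurable_bool_real; apply: measurable_fun_ler => //; exact: mB.
have md : measurable_fun setT (fun w => 2 * deviation_bound delta gamma' k w).
  by apply: measurable_funM => //; exact: measurable_deviation_bound.
have d0 w := deviation_bound_ge0 delta gamma' k w.
apply: (@le_trans _ _ (\int[P]_w (2 * deviation_bound delta gamma' k w +
    round_cost A kappa (stats k w).1 * (b0 <= B k.+1 w)%R%:R)%:E)%E).
  apply: ge0_le_integral_real.
  - exact: ucb_gap_ge0.
  - exact: measurable_ucb_gap.
  - exact: measurable_funD.
  - by move=> w; exact: ucb_gap_le.
rewrite ge0_integralD_real//; last by move=> w; exact: mulr_ge0.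
apply: leeD; last exact: expectation_round_cost.
rewrite ge0_integralZl_real//; last exact: measurable_deviation_bound.
(* One factor 2 is the trivial gap, the other counts the two signs of the deviation. *)
rewrite (_ : 4 = 2 * 2); last by rewrite -natrM.
rewrite -mulrA EFinM; apply: lee_wpmul2l => //.
exact: expectation_deviation_bound.
Qed.

(** Gaps lie in [[0, 2]], so their expectations are real numbers [r t] and the extended-real
    difference can be rearranged. *)
Lemma regretE n : (regret P v F gamma V M n =
  \sum_(1 <= t < n.+1) \int[P]_w (ucb_gap t w)%:E)%E.
Proof.
pose r t := fine (\int[P]_w (ucb_gap t w)%:E)%E.
have gapE k : (\int[P]_w (ucb_gap k.+1 w)%:E = (r k.+1)%:E)%E.
  rewrite /r fineK// fin_numElt; apply/andP; split.
    apply: lt_le_trans (_ : 0 <= _)%E; first exact: ltNyr.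
    by apply: integral_ge0 => w _; rewrite lee_fin ucb_gap_ge0.
  apply: le_lt_trans (ltry 2); rewrite -[leRHS](integral_cst_probability P).
  apply: ge0_le_integral_real => //.
  - exact: ucb_gap_ge0.
  - exact: measurable_ucb_gap.
  - exact: ucb_gap_le2.
have intg k : P.-integrable setT (EFin \o ucb_gap k.+1).
  apply/integrableP; split; first exact/measurable_EFinP/measurable_ucb_gap.
  under eq_integral => w _ do rewrite /= ger0_norm ?ucb_gap_ge0//.
  by rewrite gapE ltry.
have UE k : (\int[P]_w (U v F (B k.+1 w))%:E = (Umax v F - r k.+1)%:E)%E.
  have e w : U v F (B k.+1 w) = U v F b0 - ucb_gap k.+1 w by rewrite /ucb_gap subKr.
  under eq_integral do rewrite e EFinB.
  rewrite integralB_EFin//; last exact: finite_measure_integrable_cst.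
  rewrite integral_cst_probability gapE -EFinB; congr ((_ - _)%:E).
  by rewrite (Umax_argmax b0_argmax).
rewrite /regret !big_add1 /=.
under eq_bigr do rewrite UE; under [RHS]eq_bigr do rewrite gapE.
rewrite !sumEFin -EFinB; congr EFin.
by rewrite sumrB sumr_const_nat subn0 mulr_natl subKr.
Qed.

End regret_decomposition.

End ucb_probability.

(** * Summation over the rounds *)

Unset Implicit Arguments.
Set Strict Implicit.
Set Printing Implicit Defensive.

Theorem theorem3 (R : realType) (d : measure_display) (T : measurableType d)
  (P : probability T R) (V M : nat -> T -> R) (v : R) (F f : R -> R)
  (Delta c_f C_f lambda gamma : R) :
  (* the model: (V_t) i.i.d. in [0,1] with mean v, (M_t) i.i.d. in [0,1] with CDF F,
     all mutually independent *)
  (forall t, measurable_fun setT (V t)) ->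
  (forall t, measurable_fun setT (M t)) ->
  (forall t w, 0 <= V t w <= 1) ->
  (forall t w, 0 <= M t w <= 1) ->
  (forall t A, measurable A -> P (V t @^-1` A) = P (V 1 @^-1` A)) ->
  (forall t b, P [set w | M t w <= b] = (F b)%:E) ->
  mutually_independent P (fun i : nat + nat =>
    match i with inl t => V t | inr t => M t end) ->
  (\int[P]_w (V 1 w)%:E = v%:E)%E ->
  (* Assumption 1 *)
  {within `[0, 1], continuous F} ->
  (forall b, b \in `]0, 1[ -> derivable F b 1 /\ derive1 F b = f b) ->
  {in `]0, 1[, continuous f} ->
  {in `]0, 1[ &, forall x y, x < y -> f y / F y < f x / F x} ->
  (* Assumption 2 *)
  0 < Delta -> 0 < c_f ->
  (forall b, b \in `[bstar v F - Delta, bstar v F + Delta] -> c_f < f b < C_f) ->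
  (forall b, b \in `[bstar v F, bstar v F + Delta] ->
     derivable (fun x => x + F x / f x) b 1 /\
     derive1 (fun x => x + F x / f x) b <= lambda) ->
  0 < F (bstar v F) ->
  1 < gamma ->
  exists C : R, forall TT : nat, (2 <= TT)%N ->
    (regret P v F gamma V M TT <=
     ((2 * gamma * lambda * C_f ^+ 2 / (F (bstar v F) * c_f)) * ln (TT%:R) ^+ 2
      + C * ln (TT%:R))%:E)%E.
Proof.
move=> mV mM V01 M01 idV cdfM indepVM meanV cF dF _ slc D0 cf0 f_bounds phi' Fb0 gamma1.
have gamma0 : 0 < gamma := lt_trans ltr01 gamma1.
have [delta [gamma' [delta0 gamma'1 peeling]]] := peel gamma1.
have [C0 C00 slices] := peel_slices_le delta0 gamma'1.
have clam : 0 <= C_f * lambda.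
  exact: (lambda_C_f_ge0 mV mM V01 M01 cdfM meanV cF Fb0 dF slc D0 cf0 f_bounds phi').
have Cf_gt : c_f < C_f.
  have /f_bounds/andP[] : bstar v F \in `[bstar v F - Delta, bstar v F + Delta].
    by rewrite in_itv/=; apply/andP; split; lra.
  exact: lt_trans.
have ln2 : 0 < ln 2 :> R by rewrite ln_gt0// ltr1n.
set FB := F (bstar v F) in Fb0 *.
pose a := C_f * lambda * gamma.
have a0 : 0 <= a by rewrite mulr_ge0// ltW.
pose kap := 2 * gamma / Delta ^+ 2.
(* The first summand absorbs the constant terms through [ln 2 <= L], the second the harmonic sum of
   the bad rounds, and the last the part of the exploration cost that is linear in [L]. *)
exists ((2 + 4 * C0) / ln 2 + 4 * C0 + FB^-1 * (a + 2 * kap)) => n n2.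
have n0 : (0 < n)%N by exact: leq_trans n2.
set L := ln n%:R.
have Lge : ln 2 <= L by rewrite ler_ln ?posrE ?ltr0n// ler_nat.
have L0 : 0 <= L by lra.
(* Round 1 precedes any observation and is charged the trivial gap 2. After the shift, [k] is the
   number of completed rounds. *)
rewrite (regretE gamma mV mM V01 cdfM meanV cF) big_ltn// big_add1/=.
have A0 : 0 <= a * L by exact: mulr_ge0.
have kap0 : 0 <= kap * L.
  by apply: mulr_ge0 => //; rewrite divr_ge0 ?sqr_ge0// mulr_ge0// ltW.
have gap1 : (\int[P]_w (ucb_gap V M v F gamma 1 w)%:E <= 2%:E)%E.
  rewrite -[leRHS](integral_cst_probability P); apply: ge0_le_integral_real => //.
  - by move=> w; apply: ucb_gap_ge0.
  - exact: (measurable_ucb_gap v gamma mV mM cdfM cF).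
  - move=> w; exact: (ucb_gap_le2 gamma mV mM V01 cdfM meanV cF).
pose cost k := (\int[P]_w (round_cost (a * L) (kap * L) (ucb_stats F gamma V M k w).1 *
   (ucb_win F gamma V M k.+1 w)%:R)%:E)%E.
have gaps : (\sum_(1 <= k < n) \int[P]_w (ucb_gap V M v F gamma k.+1 w)%:E <=
    (4 * C0 * (1 + L))%:E + FB^-1%:E * (a * L * (1 + L) + 2 * (kap * L))%:E)%E.
  apply: (@le_trans _ _ (\sum_(1 <= k < n) ((4 * C0 * k%:R^-1)%:E + FB^-1%:E * cost k))%E).
    rewrite !big_nat; apply: lee_sum => k /andP[k0 kn].
    have kn' : (0 < k <= n)%N by rewrite k0 ltnW.
    apply: le_trans (expectation_ucb_gap mV mM V01 M01 idV cdfM indepVM meanV cF Fb0 dF slc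
      D0 cf0 f_bounds phi' gamma0 peeling kn') _.
    apply: leeD => //; rewrite lee_fin -mulrA; apply: ler_wpM2l => //.
    have := slices (ln k%:R) _; rewrite ln_ge0 ?ler1n// => /(_ isT).
    by rewrite [expR (- ln _)]expRN lnK ?posrE ?ltr0n.
  rewrite big_split/=; apply: leeD.
    rewrite sumEFin lee_fin -mulr_sumr; apply: ler_wpM2l; first by rewrite mulr_ge0.
    apply: le_trans (harmonic_le n); rewrite big_nat_recr//=.
    by rewrite lerDl invr_ge0.
  rewrite -ge0_sume_distrr; last first.
    move=> k _; apply: integral_ge0 => w _; rewrite lee_fin mulr_ge0//.
    by rewrite addr_ge0// mulr_ge0// powR_ge0.
  apply: lee_wpmul2l; first by rewrite lee_fin invr_ge0 ltW.
  exact: (expectation_exploration gamma mV mM M01 cdfM cF).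
apply: le_trans (leeD gap1 gaps) _.
rewrite -EFinM -!EFinD lee_fin -/L.
have h1 : 2 + 4 * C0 <= (2 + 4 * C0) / ln 2 * L.
  by rewrite -mulrA ler_peMr//; [lra|rewrite mulrC ler_pdivlMr// mul1r].
have h2 : FB^-1 * (a * L ^+ 2) <=
    2 * gamma * lambda * C_f ^+ 2 / (FB * c_f) * L ^+ 2.
  have -> : 2 * gamma * lambda * C_f ^+ 2 / (FB * c_f) * L ^+ 2 =
      FB^-1 * (a * L ^+ 2) * (2 * (C_f / c_f)).
    by rewrite /a; field; rewrite !gt_eqF.
  rewrite ler_peMr//; first by rewrite mulr_ge0 ?invr_ge0 ?(ltW Fb0)// mulr_ge0 ?sqr_ge0.
  have : 1 <= C_f / c_f by rewrite ler_pdivlMr// mul1r ltW.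
  lra.
have e : FB^-1 * (a * L * (1 + L) + 2 * (kap * L)) =
  FB^-1 * (a * L ^+ 2) + FB^-1 * (a + 2 * kap) * L by ring.
rewrite e; lra.
Qed.
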